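(* Let $\sigma_0\in(\frac12,1)$. Let $(g_k)_{k\ge 1}$ be functions $g_k:\mathbb{R}_+\to\mathbb{R}$ such that, for every $k\ge1$, $\int_0^\infty |g_k(x)|\,dx<\infty$ and $\int_0^\infty |g_k(x)|\,\frac{dx}{x}<\infty$. Let $\phi:\mathbb{R}_+\to\mathbb{R}$ be such that $\int_0^\infty (1+t)|\phi(t)|^2\,dt<\infty$ and such that its Mellin transform $\widehat{\phi}(s)$ does not vanish in the strip $\frac12<\mathrm{Re}(s)\le\sigma_0$. Suppose that there exist real coefficients $(c_{k,n})_{1\le k\le n,\, n\ge1}$ and a sequence $M_n\to\infty$ such that, as $n\to\infty$, $$M_n^{2\sigma_0-1}\int_0^\infty\left(\phi(t)-\sum_{k=1}^n c_{k,n}\,g_k^\times(t)\right)^2dt\longrightarrow 0$$ and $$M_n^{\sigma_0-1}\int_{M_n}^\infty\left|\sum_{k=1}^n c_{k,n}\,g_k(t)\right|dt\longrightarrow 0.$$ Then the Riemann zeta function $\zeta(s)$ does not vanish in the strip $\frac12<\mathrm{Re}(s)\le\sigma_0$.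
   Context: All functions are (Lebesgue) measurable. $\{y\}$ denotes the fractional part of a real number $y$. For $g:\mathbb{R}_+\to\mathbb{R}$ with $\int_0^\infty|g(x)|\,dx<\infty$ and $\int_0^\infty |g(x)|\frac{dx}{x}<\infty$, define for $t>0$ $$g^\times(t)=\int_0^\infty\left\{\frac{x}{t}\right\}g(x)\,\frac{dx}{x},$$ and write $g_k^\times=(g_k)^\times$. The Mellin transform of a function $\phi$ is $\widehat{\phi}(s)=\int_0^\infty\phi(x)x^{s-1}\,dx$; under the assumption $\int_0^\infty(1+t)|\phi(t)|^2dt<\infty$ this integral converges absolutely for $\frac12<\mathrm{Re}(s)<1$. *)

(* Defs.v *)
From HB Require Import structures.
From mathcomp Require Import all_boot all_order all_algebra.
From mathcomp Require Import complex.
From mathcomp Require Import all_classical all_reals all_analysis.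

Set Implicit Arguments.
Unset Strict Implicit.
Unset Printing Implicit Defensive.

Import Order.TTheory GRing.Theory Num.Theory.
Import numFieldNormedType.Exports.

Local Open Scope classical_set_scope.
Local Open Scope ring_scope.
Local Open Scope complex_scope.

(* The completed measure is used so that measurability and integrability are
   those of Lebesgue (and not only Borel) measurable functions. *)
Notation leb := (completed_lebesgue_measure (R := _)).

(* Functions on the positive half-line are total functions R -> R that are only
   measured and integrated on subsets of this interval. *)
Notation Rpos := `]0, +oo[%classic.

Definition lebesgue_measurable (R : realType) (D : set R) (f : R -> R) : Prop :=
  @measurable_fun _ _ (caratheodory_type (wlength (R := R) idfun)^*%mu) R D f.

Definition fracpart (R : realType) (y : R) : R := y - (Num.floor y)%:~R.

Definition gcross (R : realType) (g : R -> R) (t : R) : R :=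
  \int[leb]_(x in Rpos) (fracpart (x / t) * g x / x).

(* x ^ s = exp (s * ln x); meaningful for 0 < x only. *)
Definition cpow (R : realType) (x : R) (s : R[i]) : R[i] :=
  (x `^ complex.Re s)%:C * (cos (complex.Im s * ln x) +i* sin (complex.Im s * ln x)).

Definition cintegral (R : realType) (D : set R) (f : R -> R[i]) : R[i] :=
  (\int[leb]_(x in D) complex.Re (f x)) +i* (\int[leb]_(x in D) complex.Im (f x)).

Definition mellin (R : realType) (phi : R -> R) (s : R[i]) : R[i] :=
  cintegral Rpos (fun x => (phi x)%:C * cpow x (s - 1)).

Definition analytic_at (R : realType) (f : R[i] -> R[i]) (a : R[i]) : Prop :=
  exists (c : nat -> R[i]) (r : R), 0 < r /\
    forall z : R[i], `|z - a| < r%:C ->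
      (series (fun n => c n * (z - a) ^+ n) : nat -> R[i]^o) @ \oo --> (f z : R[i]^o).

(* zeta is the analytic continuation to C \ {1} of the sum of n ^ (- s) over
   n >= 1; by the identity theorem this determines it on C \ {1}, and its value
   at 1 is irrelevant. *)
Definition is_riemann_zeta (R : realType) (zeta : R[i] -> R[i]) : Prop :=
  (forall s : R[i], 1 < complex.Re s ->
     (series (fun n => cpow n.+1%:R (- s)) : nat -> R[i]^o) @ \oo --> (zeta s : R[i]^o)) /\
  (forall a : R[i], a != 1 -> analytic_at zeta a).

(* Main.v *)
Require Import Defs.
From HB Require Import structures.
From mathcomp Require Import all_boot all_order all_algebra.
From mathcomp Require Import complex.
From mathcomp Require Import all_classical all_reals all_analysis.
From mathcomp Require Import ring lra measurable_realfun.

Set Implicit Arguments.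
Unset Strict Implicit.
Unset Printing Implicit Defensive.

Import Order.TTheory GRing.Theory Num.Theory.
Import numFieldNormedType.Exports.

Local Open Scope classical_set_scope.
Local Open Scope ring_scope.

(** Let [zeta s = 0] with [1/2 < Re s <= sigma0]; it is shown that the Mellin
    transform of [phi] vanishes at [s], contrary to its hypothesis.  Put
    [sigma = Re s], and write {y} for the fractional part of [y].

    The link with zeta is that, for [x > 0] and [0 < Re s < 1], the integral of
    [{x/t} t^(s-1)] over [t > 0] equals [- x^s zeta(s) / s].  At a zero of zeta it
    vanishes ([mellin_fracpart_eq0]), so that by Fubini the integral of
    [g^x(t) t^(s-1)] vanishes for every admissible [g] ([integral_gcross_eq0]).
    Let [G] be the [n]-th linear combination of the [g_k], [M = M_n] and
    [f = phi - G^x].  Then the Mellin transform of [phi] at [s] is the integral of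
    [f(t) t^(s-1)], for every [n], and it remains to see that the integral of
    [|f| t^(sigma-1)] tends to 0 with [n].

    The function [f] is small in [L^2], but [t^(sigma-1)] is square integrable
    only near 0, so the half-line has to be cut.  On [0 < t <= 2M] the
    Cauchy-Schwarz inequality gives a bound by a multiple of
    [M^(sigma-1/2) ||f||_2], which tends to 0 by the first limit in the
    hypotheses.  For [t > M] the fractional part [{x/t}] is [x/t] on [x <= M], so
    [t G^x(t)] is the constant [A], the integral of [G], up to the error [E], the
    integral of [|G|] over [x > M] ([gcross_tail]).  Hence [|f|] is at most
    [|phi| + (|A| + E)/t] there.  The part of [phi] is the tail of an absolutely
    convergent integral, and [E M^(sigma-1)] tends to 0 by the second limit.
    Nothing is assumed on the size of [A], but [A/t] is within [E/t] of
    [phi - f] on [M < t <= 2M], where [phi] and [f] are both under control;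
    integrating there bounds [|A| M^(sigma-1)] by quantities that tend to 0
    ([approx_error_le]).

    The formula for the integral of [{x/t} t^(s-1)] is proved by analytic
    continuation, separately on [t <= x] and on [t > x].  The first integral is
    analytic for [Re s > 0], and for real [s > 1] it can be summed over the
    intervals where the integer part of [x/t] is constant, which brings in the
    series of zeta ([integral_fracpart_powR]).  The second is analytic for
    [Re s < 1] and elementary for real [s].  This needs two facts on functions
    given locally by power series: the identity theorem along segments
    ([identity_on_segment]) and the analyticity of Laplace integrals
    ([analytic_laplace]). *)

(** * Complex modulus and convergence *)

Lemma squeeze_cvg0 (R : realType) (u v : nat -> R) :
  (forall n, 0 <= u n <= v n) ->
  v n @[n --> \oo] --> (0 : R) -> u n @[n --> \oo] --> (0 : R).
Proof.
move=> uv v0; apply: (@squeeze_cvgr _ _ _ _ (cst 0) v) => //; last exact: cvg_cst.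
exact: nearW.
Qed.

Section ComplexNorm.
Variable R : realType.
Implicit Types (z w : R[i]).
Local Open Scope complex_scope.
Local Notation normc := Normc.normc.

Lemma normcE z : `|z| = (normc z)%:C.
Proof. by rewrite normc_def; case: z. Qed.

Lemma normc_ge0 z : 0 <= normc z.
Proof. by rewrite -ler0c -normcE. Qed.

Lemma normcD z w : normc (z + w) <= normc z + normc w.
Proof. exact: le_normcD. Qed.

Lemma normcNE z : normc (- z) = normc z.
Proof. exact: normcN. Qed.

Lemma normcX z n : normc (z ^+ n) = normc z ^+ n.
Proof.
elim: n => [|n IH]; first by rewrite !expr0 Normc.normc1.
by rewrite !exprS Normc.normcM IH.
Qed.

Lemma normc_real (x : R) : normc x%:C = `|x|.
Proof. by rewrite /normc /= expr0n /= addr0 sqrtr_sqr. Qed.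

Lemma normc_gt0 z : (0 < normc z) = (z != 0).
Proof.
rewrite lt_def normc_ge0 andbT; congr (~~ _).
by apply/eqP/eqP => [/Normc.eq0_normc|->]; rewrite ?Normc.normc0.
Qed.

Lemma normc_sum (I : Type) (r : seq I) (P : pred I) (F : I -> R[i]) :
  normc (\sum_(i <- r | P i) F i) <= \sum_(i <- r | P i) normc (F i).
Proof.
elim/big_rec2 : _ => [|i x y _ IH]; first by rewrite Normc.normc0.
by rewrite (le_trans (normcD _ _))// lerD2l.
Qed.

Lemma cReD z w : complex.Re (z + w) = complex.Re z + complex.Re w.
Proof. by case: z w => [? ?] [? ?]. Qed.
Lemma cImD z w : complex.Im (z + w) = complex.Im z + complex.Im w.
Proof. by case: z w => [? ?] [? ?]. Qed.
Lemma cReM z w : complex.Re (z * w) =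
  complex.Re z * complex.Re w - complex.Im z * complex.Im w.
Proof. by case: z w => [? ?] [? ?]. Qed.
Lemma cImM z w : complex.Im (z * w) =
  complex.Re z * complex.Im w + complex.Im z * complex.Re w.
Proof. by case: z w => [? ?] [? ?]; rewrite /= [X in _ + X]mulrC. Qed.
Lemma cReB z w : complex.Re (z - w) = complex.Re z - complex.Re w.
Proof. exact: raddfB. Qed.
Lemma cImB z w : complex.Im (z - w) = complex.Im z - complex.Im w.
Proof. exact: raddfB. Qed.

Lemma ler_Re_normc z : `|complex.Re z| <= normc z.
Proof. by rewrite -lecR -normcE normc_ge_Re. Qed.

Lemma ler_Im_normc z : `|complex.Im z| <= normc z.
Proof.
case: z => a b /=; rewrite -(sqrtr_sqr b) ler_sqrt ?addr_ge0 ?sqr_ge0//.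
by rewrite lerDr sqr_ge0.
Qed.

Lemma normc_le_ReIm z : normc z <= `|complex.Re z| + `|complex.Im z|.
Proof.
rewrite [z in leLHS]complexE (le_trans (normcD _ _))// normc_real lerD2l.
rewrite Normc.normcM normc_real ler_piMl//.
by rewrite /normc /= expr0n /= add0r expr1n sqrtr1.
Qed.

(** Reduces convergence in the topology of the complex numbers to a real limit,
    so that the complex limits below can be proved by squeezing. *)
Lemma cvgC_normc (u : nat -> R[i]) (l : R[i]) :
  ((u : nat -> R[i]^o) @ \oo --> (l : R[i]^o)) <->
  (normc (u n - l) @[n --> \oo] --> (0 : R)).
Proof.
split=> [/cvgrPdist_lt H|/cvgrPdist_lt H]; apply/cvgrPdist_lt => e e0.
  have e0' : 0 < e%:C by rewrite ltcR.
  move: (H _ e0'); apply: filterS => n /=.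
  by rewrite normcE ltcR sub0r normrN ger0_norm ?normc_ge0// -normcNE opprB.
case: e e0 => e e' /=; rewrite ltcE /= => /andP[/eqP -> e0].
move: (H _ e0); apply: filterS => n /=.
rewrite sub0r normrN ger0_norm ?normc_ge0// -normcNE opprB => h.
by rewrite (_ : e +i* 0 = e%:C)// normcE ltcR.
Qed.

End ComplexNorm.

(** * Power series and the identity theorem *)

Section PowerSeries.
Variable R : realType.
Implicit Types (c : nat -> R[i]) (z w : R[i]) (f : R[i] -> R[i]).
Local Open Scope complex_scope.
Local Notation normc := Normc.normc.

Definition pser_cvg c z l : Prop :=
  normc (\sum_(0 <= n < N) c n * z ^+ n - l) @[N --> \oo] --> (0 : R).

Lemma analytic_atP f a : analytic_at f a <->
  exists c (r : R), 0 < r /\ forall z, normc z < r -> pser_cvg c z (f (a + z)).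
Proof.
split=> [[c [r [r0 H]]]|[c [r [r0 H]]]]; exists c, r; split => // z zr.
  have := H (a + z); rewrite addrAC subrr add0r normcE ltcR => /(_ zr).
  by move/cvgC_normc.
have zr' : normc (z - a) < r by move: zr; rewrite normcE ltcR.
by have := H _ zr'; rewrite subrKC => /cvgC_normc.
Qed.

Lemma pser_cvg_bounded c z l : pser_cvg c z l ->
  exists K : R, forall n, normc (c n) * normc z ^+ n <= K.
Proof.
move=> h; have /cvg_seq_bounded [M [_ /(_ (M + 1))]] : cvgn (fun N => normc (\sum_(0 <= n < N) c n * z ^+ n - l)).
  by apply/cvg_ex; exists 0.
rewrite ltrDl ltr01 => /(_ isT) H; exists (M + 1 + (M + 1)) => n.
have := H n I; have := H n.+1 I.
rewrite /= !ger0_norm ?normc_ge0// big_nat_recr//= => h1 h2.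
rewrite -normcX -Normc.normcM (le_trans _ (lerD h1 h2))//.
rewrite -[X in _ <= _ + X]normcNE (le_trans _ (normcD _ _))//.
by rewrite (_ : _ - _ = c n * z ^+ n)//; ring.
Qed.

Lemma geo_half_sum (q : R) k : 0 <= q -> q <= 2^-1 -> \sum_(0 <= i < k) q ^+ i <= 2.
Proof.
move=> q0 q2; have q1 : 2^-1 <= 1 - q by lra.
have : (1 - q) * \sum_(0 <= i < k) q ^+ i <= 1.
  have := subrX1 q k; rewrite big_mkord => /(congr1 -%R).
  rewrite opprB -mulNr opprB => <-.
  by rewrite lerBlDr lerDl exprn_ge0.
have S0 : 0 <= \sum_(0 <= i < k) q ^+ i by apply: sumr_ge0 => i _; exact: exprn_ge0.
nra.
Qed.

(** Uniqueness of power series coefficients, from the values on a short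
    segment only.  If the coefficients before [c n] vanish, a zero sum at radius [q * v] bounds
    [normc (c n) * v ^+ n] by the rest of the series divided by [q ^+ n], which is
    [O(q)] by comparison with the bounded terms at radius [v]. *)
Lemma pser_cvg_eq0 c u (d : R) : u != 0 -> 0 < d ->
  (forall t : R, 0 < t -> t < d -> pser_cvg c (t%:C * u) 0) -> forall n, c n = 0.
Proof.
move=> u0 d0 H; elim/ltn_ind => n IH.
pose t0 := d / 2; have t00 : 0 < t0 by rewrite divr_gt0.
have t0d : t0 < d by rewrite /t0; lra.
have [K HK] := pser_cvg_bounded (H _ t00 t0d).
have K0 : 0 <= K by rewrite (le_trans _ (HK 0%N))// mulr_ge0 ?exprn_ge0 ?normc_ge0.
set v := normc (t0%:C * u) in HK.
have v0 : 0 < v by rewrite /v Normc.normcM normc_real gtr0_norm// mulr_gt0// normc_gt0.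
have key (q : R) : 0 < q -> q <= 2^-1 -> normc (c n) * v ^+ n <= K * q * 2.
  move=> q0 q2.
  have qd : q * t0 < d by rewrite /t0; nra.
  have := H _ (mulr_gt0 q0 t00) qd.
  set z := (_ * u).
  have zE : normc z = q * v by rewrite /z rmorphM -mulrA Normc.normcM normc_real gtr0_norm.
  move=> hz; apply/ler_addgt0Pr => e e0.
  have qn0 : 0 < q ^+ n by rewrite exprn_gt0.
  move/cvgrPdist_lt : hz => /(_ _ (mulr_gt0 e0 qn0)) [N _ HN].
  have := HN (n.+1 + N)%N (leq_addl _ _).
  rewrite /= sub0r normrN ger0_norm ?normc_ge0// subr0.
  rewrite (big_cat_nat (n := n.+1))//= ?leq_addr// big_nat_recr//=.
  rewrite big_nat big1 ?add0r; last by move=> i /andP[_ /IH ->]; rewrite mul0r.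
  rewrite -[X in \sum_(X <= _ < _) _]add0n big_addn addKn => hS.
  rewrite -(ler_pM2r qn0) -[X in X <= _]mulrA -exprMn [v * q]mulrC -zE -normcX -Normc.normcM.
  rewrite mulrDl; set A := c n * _ in hS *; set B := \sum_(_ <= _ < _) _ in hS.
  have : normc A <= normc (A + B) + normc B.
    by rewrite -[normc B]normcNE (le_trans _ (normcD _ _))// addrK.
  move/le_trans; apply; rewrite addrC lerD ?(ltW hS)//.
  apply: (le_trans (normc_sum _ _ _)).
  apply: (@le_trans _ _ (\sum_(0 <= i < N) (K * q ^+ n.+1) * q ^+ i)).
    apply: ler_sum => i _.
    rewrite Normc.normcM normcX zE exprMn [q ^+ _ * _]mulrC mulrA -[leRHS]mulrA -exprD.
    rewrite [(n.+1 + i)%N]addnC.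
    by apply: ler_wpM2r; [rewrite exprn_ge0// ltW|exact: HK].
  rewrite -mulr_sumr exprS [leRHS]mulrAC mulrA.
  by apply: ler_wpM2l; [rewrite !mulr_ge0// ltW|rewrite geo_half_sum// ltW].
have : normc (c n) * v ^+ n <= 0.
  apply/ler_addgt0Pr => e e0; rewrite add0r.
  pose q := Num.min 2^-1 (e / (2 * (K + 1))).
  have K1 : 0 < 2 * (K + 1) by lra.
  have q0 : 0 < q by rewrite lt_min invr_gt0 ltr0n /= divr_gt0.
  have q2 : q <= 2^-1 by rewrite ge_min lexx.
  apply: (le_trans (key q q0 q2)).
  have : q <= e / (2 * (K + 1)) by rewrite ge_min lexx orbT.
  rewrite ler_pdivlMr// => h; nra.
rewrite pmulr_lle0 ?exprn_gt0// => h; apply: Normc.eq0_normc.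
by apply/eqP; rewrite eq_le h normc_ge0.
Qed.

End PowerSeries.

Section Continuation.
Variable R : realType.
Implicit Types (f g : R[i] -> R[i]) (a b z : R[i]).
Local Open Scope complex_scope.
Local Notation normc := Normc.normc.

Definition vanishes_near f a : Prop :=
  exists2 r : R, 0 < r & forall z, normc z < r -> f (a + z) = 0.

Lemma vanishes_near_at f a : vanishes_near f a -> f a = 0.
Proof. by case=> r r0 /(_ 0); rewrite addr0; apply; rewrite Normc.normc0. Qed.

Lemma pser_cvg_uniq c z l l' : pser_cvg c z l -> pser_cvg c z l' -> l = l' :> R[i].
Proof.
move=> h h'; apply/eqP; rewrite -subr_eq0; apply/eqP/Normc.eq0_normc/le_anti.
rewrite normc_ge0 andbT.
apply/ler_addgt0Pr => e e0; rewrite add0r.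
have e20 : 0 < e / 2 by rewrite divr_gt0.
move/cvgrPdist_lt : h => /(_ _ e20) [N _ HN].
move/cvgrPdist_lt : h' => /(_ _ e20) [N' _ HN'].
have := HN (N + N')%N (leq_addr _ _); have := HN' (N + N')%N (leq_addl _ _).
rewrite /= !sub0r !normrN !ger0_norm ?normc_ge0// => h1 h2.
rewrite [e]splitr (le_trans _ (ltW (ltrD h1 h2)))//.
rewrite -[X in _ <= _ + X]normcNE (le_trans _ (normcD _ _))//.
by rewrite (_ : _ - _ + _ = l - l')//; ring.
Qed.

(** Vanishing on one ray is enough: this lets the identity theorem start from the
    real axis, and it passes from an open segment to its end point. *)
Lemma vanishes_near_direction f a u (d : R) : analytic_at f a -> u != 0 -> 0 < d ->
  (forall t : R, 0 < t -> t < d -> f (a + t%:C * u) = 0) -> vanishes_near f a.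
Proof.
move=> /analytic_atP[c [r [r0 H]]] u0 d0 hf.
have nu : 0 < normc u by rewrite normc_gt0.
have c0 : forall n, c n = 0.
  apply: (@pser_cvg_eq0 _ c u (Num.min d (r / normc u))) => //.
    by rewrite lt_min d0 divr_gt0.
  move=> t t0; rewrite lt_min => /andP[td tr].
  rewrite -(hf t t0 td); apply: H.
  by rewrite Normc.normcM normc_real gtr0_norm// -ltr_pdivlMr.
exists r => // z /H h; apply: (pser_cvg_uniq h).
apply: cvg_near_cst; apply: nearW => N.
by rewrite big1 ?subr0 ?Normc.normc0// => i _; rewrite c0 mul0r.
Qed.

Lemma vanishes_near_open f a : vanishes_near f a ->
  exists2 r : R, 0 < r & forall z, normc z < r -> vanishes_near f (a + z).
Proof.
move=> [r r0 H]; exists r => // z zr; exists (r - normc z); first by rewrite subr_gt0.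
move=> w; rewrite ltrBrDl => hw; rewrite -addrA; apply: H.
exact: le_lt_trans (normcD _ _) hw.
Qed.

(** Let [T] be the supremum of the parameters up to which [f] vanishes locally.
    Approaching [T] from below, [vanishes_near_direction] gives local vanishing
    at [T] itself, and as local vanishing is open, [T < 1] is impossible. *)
Lemma identity_on_segment f a b :
  (forall t : R, 0 <= t <= 1 -> analytic_at f (a + t%:C * (b - a))) ->
  vanishes_near f a -> vanishes_near f b.
Proof.
move=> fan f0; set u := b - a in fan.
have [u0|u0] := eqVneq u 0; first by rewrite -[b](subrK a) -/u u0 add0r.
pose p (t : R) := a + t%:C * u.
pose S := [set t : R | 0 <= t <= 1 /\ forall t', 0 <= t' <= t -> vanishes_near f (p t')].
have p0 : vanishes_near f (p 0) by rewrite /p mul0r addr0.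
have S0 : S 0.
  by split; [rewrite lexx ler01|move=> t' /le_anti <-].
have hS : has_sup S.
  by split; [exists 0|exists 1 => t [/andP[_ ?] _]].
set T := sup S.
have T0 : 0 <= T by apply: (ub_le_sup hS.2).
have T1 : T <= 1 by apply: ge_sup => [|t [/andP[_ ?] _]//]; exists 0.
have below t : 0 <= t < T -> vanishes_near f (p t).
  move=> /andP[t0 tT]; have Tt : 0 < T - t by rewrite subr_gt0.
  have [s [_ hs]] := sup_adherent Tt hS.
  by rewrite opprB addrC subrK => ts; apply: hs; rewrite t0 ltW.
have pT : vanishes_near f (p T).
  have [->//|T00] := eqVneq T 0.
  have Tp : 0 < T by rewrite lt_def T00.
  apply: (@vanishes_near_direction f (p T) (- u) T) => //.
  - by apply: fan; rewrite T0.
  - by rewrite oppr_eq0.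
  - move=> t t0 tT; rewrite (_ : _ + _ = p (T - t)); last by rewrite /p rmorphB/=; ring.
    by apply/vanishes_near_at/below; rewrite subr_ge0 (ltW tT) ltrBlDr ltrDl.
suff T1' : T = 1 by move: pT; rewrite T1' /p mul1r /u addrC subrK.
apply/eqP; rewrite eq_le T1 leNgt; apply/negP => Tlt1.
have [r r0 hr] := vanishes_near_open pT.
have nu : 0 < normc u by rewrite normc_gt0.
pose e := Num.min (1 - T) (r / normc u / 2).
have e0 : 0 < e by rewrite lt_min subr_gt0 Tlt1 !divr_gt0.
have eT : e <= 1 - T by rewrite ge_min lexx.
have er : e * normc u < r.
  have : e <= r / normc u / 2 by rewrite ge_min lexx orbT.
  move=> h; rewrite -ltr_pdivlMr// (le_lt_trans h)//.
  have : 0 < r / normc u by rewrite divr_gt0.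
  by lra.
have : S (T + e).
  split; first by apply/andP; split; lra.
  move=> t' /andP[t'0 t'T].
  have [h|h] := ltP t' T; first by apply: below; rewrite t'0.
  rewrite (_ : p t' = p T + (t' - T)%:C * u); last by rewrite /p rmorphB/=; ring.
  apply: hr; rewrite Normc.normcM normc_real ger0_norm ?subr_ge0//.
  by apply: le_lt_trans er; rewrite ler_wpM2r ?normc_ge0//; lra.
by move/(ub_le_sup hS.2); rewrite -/T; lra.
Qed.

End Continuation.

(** * Analytic functions *)

Section AnalyticClosure.
Variable R : realType.
Implicit Types (f g : R[i] -> R[i]) (a b z : R[i]).
Local Open Scope complex_scope.
Local Notation normc := Normc.normc.

Lemma analytic_cst (k : R[i]) a : analytic_at (fun=> k) a.
Proof.
apply/analytic_atP; exists (fun n => if n is 0%N then k else 0), 1; split=> // z _.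
apply: cvg_near_cst; exists 1%N => // -[//|N] _ /=.
by rewrite big_nat_recl//= big1 ?addr0 ?mulr1 ?subrr ?Normc.normc0// => i _; rewrite mul0r.
Qed.

Lemma analyticD f g a : analytic_at f a -> analytic_at g a ->
  analytic_at (fun s => f s + g s) a.
Proof.
move=> /analytic_atP[c [r [r0 H]]] /analytic_atP[c' [r' [r'0 H']]].
apply/analytic_atP; exists (fun n => c n + c' n), (Num.min r r').
split=> [|z]; first by rewrite lt_min r0.
rewrite lt_min => /andP[/H h /H' h'].
have /(_ _) hs := cvgD h h'; rewrite addr0 in hs; apply: (squeeze_cvg0 _ hs) => N /=.
rewrite normc_ge0/= (le_trans _ (normcD _ _))//.
rewrite (_ : _ - _ = \sum_(0 <= n < N) c n * z ^+ n - f (a + z) + (\sum_(0 <= n < N) c' n * z ^+ n - g (a + z)))//.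
rewrite (eq_bigr _ (fun i _ => mulrDl _ _ _)) big_split/=; ring.
Qed.

(** The only products that occur below have an affine factor, for which the
    coefficients of the product are explicit; this avoids Cauchy products. *)
Lemma analytic_affineM f a b : analytic_at f a ->
  analytic_at (fun s => (s - b) * f s) a.
Proof.
move=> /analytic_atP[c [r [r0 H]]].
apply/analytic_atP; exists (fun n => (a - b) * c n + if n is m.+1 then c m else 0), r.
split=> // z /H h.
pose S N := normc (\sum_(0 <= n < N) c n * z ^+ n - f (a + z)).
have h1 : S N.+1 @[N --> \oo] --> 0 by rewrite (cvg_shiftS S).
set v := (X in pser_cvg X); rewrite /pser_cvg.
rewrite -(cvg_shiftS (fun N => normc (\sum_(0 <= n < N) v n * z ^+ n - (a + z - b) * f (a + z)))) {}/v.
apply: (@squeeze_cvg0 _ _ (fun N => normc (a - b) * S N.+1 + normc z * S N)); last first.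
  rewrite -[X in _ --> X]addr0 -[X in _ --> X + _](mulr0 (normc (a - b))) -[X in _ --> _ + X](mulr0 (normc z)).
  by apply: cvgD; (apply: cvgM; first exact: cvg_cst); [exact: h1|exact: h].
move=> N; rewrite normc_ge0/= -!Normc.normcM (le_trans _ (normcD _ _))//.
rewrite [X in normc (X - _)](_ : _ = (a - b) * (\sum_(0 <= n < N.+1) c n * z ^+ n) + z * (\sum_(0 <= n < N) c n * z ^+ n)); last first.
  rewrite (eq_bigr _ (fun i _ => mulrDl _ _ _)) big_split/= !mulr_sumr.
  congr (_ + _); first by apply: eq_bigr => i _; rewrite mulrA.
  rewrite big_nat_recl//= mul0r add0r; apply: eq_bigr => i _; rewrite exprS; ring.
rewrite (_ : _ - _ = (a - b) * (\sum_(0 <= n < N.+1) c n * z ^+ n - f (a + z)) +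
  z * (\sum_(0 <= n < N) c n * z ^+ n - f (a + z)))//; ring.
Qed.

End AnalyticClosure.

(** * The complex exponential series *)

Section ExpPartialSums.
Variable F : numFieldType.
Implicit Types a b : F.

Definition exp_psum (N : nat) a : F := \sum_(0 <= n < N) a ^+ n / n`!%:R.

Lemma exp_psumS N a : exp_psum N.+1 a = exp_psum N a + a ^+ N / N`!%:R.
Proof. by rewrite /exp_psum big_nat_recr. Qed.

Lemma exp_psumD N a b :
  exp_psum N (a + b) = \sum_(0 <= i < N) a ^+ i / i`!%:R * exp_psum (N - i) b.
Proof.
elim: N => [|N IH]; first by rewrite /exp_psum !big_geq.
rewrite exp_psumS IH addrC [a + b]addrC exprDn mulr_suml.
rewrite -(big_mkord xpredT (fun i => b ^+ (N - i) * a ^+ i *+ 'C(N, i) / N`!%:R)).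
have E1 : exp_psum 1 b = 1 by rewrite /exp_psum big_nat1 divr1.
rewrite [in RHS]big_nat_recr//= subSnn E1 mulr1.
rewrite [in LHS]big_nat_recr//= subnn binn mulr1n mul1r addrAC; congr (_ + _).
rewrite -big_split/= !big_nat; apply: eq_bigr => i /andP[_ iN].
rewrite subSn 1?ltnW// exp_psumS mulrDr addrC; congr (_ + _).
rewrite -(bin_fact (ltnW iN)) !natrM -mulr_natl.
have h (k : nat) : k`!%:R != 0 :> F by rewrite pnatr_eq0 -lt0n fact_gt0.
have hb : 'C(N, i)%:R != 0 :> F by rewrite pnatr_eq0 -lt0n bin_gt0 ltnW.
field. by rewrite hb !h.
Qed.

(** The defect of multiplicativity of the partial sums has nonnegative
    coefficients in [a] and [b]; its modulus is thus at most its value at the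
    moduli of the arguments, where it tends to 0 by the real theory. *)
Lemma exp_psum_prodB N a b : exp_psum N a * exp_psum N b - exp_psum N (a + b) =
  \sum_(0 <= i < N) a ^+ i / i`!%:R * (\sum_(N - i <= j < N) b ^+ j / j`!%:R).
Proof.
rewrite exp_psumD {1}/exp_psum mulr_suml -sumrB; apply: eq_bigr => i _.
rewrite -mulrBr; congr (_ * _).
by rewrite /exp_psum (big_cat_nat (n := N - i))//= ?leq_subr// addrC addrK.
Qed.

End ExpPartialSums.

Lemma cvg_norm_sub0 (R : realType) (u : nat -> R) (l : R) :
  u n @[n --> \oo] --> l -> `|u n - l| @[n --> \oo] --> (0 : R).
Proof.
move=> h; rewrite -(normr0 R); apply: cvg_norm; rewrite -(subrr l).
by apply: cvgB => //; exact: cvg_cst.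
Qed.

Section ComplexExp.
Variable R : realType.
Implicit Types (z w : R[i]).
Local Open Scope complex_scope.
Local Notation normc := Normc.normc.

Definition cexp z : R[i] :=
  (expR (complex.Re z))%:C * (cos (complex.Im z) +i* sin (complex.Im z)).

Lemma cexpD z w : cexp (z + w) = cexp z * cexp w.
Proof.
case: z w => [a b] [c d]; rewrite /cexp /= expRD cosD sinD; simpc.
by congr (_ +i* _); ring.
Qed.

Lemma cexp_real (x : R) : cexp x%:C = (expR x)%:C.
Proof. by rewrite /cexp /= cos0 sin0 -complexr0 mulr1. Qed.

Lemma normc_cexp z : normc (cexp z) = expR (complex.Re z).
Proof.
rewrite /cexp Normc.normcM normc_real ger0_norm ?expR_ge0//.
by rewrite /normc cos2Dsin2 sqrtr1 mulr1.
Qed.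

Lemma exp_psum_real N (x : R) : exp_psum N (x%:C) = (exp_psum N x)%:C.
Proof.
rewrite /exp_psum rmorph_sum/=; apply: eq_bigr => i _.
by rewrite rmorphM/= rmorphXn/= fmorphV rmorph_nat.
Qed.

Lemma exp_psum_normc_le N z : normc (exp_psum N z) <= exp_psum N (normc z).
Proof.
rewrite (le_trans (normc_sum _ _ _))//; apply: ler_sum => i _.
by rewrite Normc.normcM normcX Normc.normcV -(rmorph_nat (real_complex R)) normc_real normr_nat.
Qed.

Lemma exp_psum_prodB_le N z w :
  normc (exp_psum N z * exp_psum N w - exp_psum N (z + w)) <=
  exp_psum N (normc z) * exp_psum N (normc w) - exp_psum N (normc z + normc w).
Proof.
have E (v : R[i]) k : normc (v ^+ k / k`!%:R) = normc v ^+ k / k`!%:R.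
  by rewrite Normc.normcM normcX Normc.normcV -(rmorph_nat (real_complex R)) normc_real normr_nat.
rewrite !exp_psum_prodB (le_trans (normc_sum _ _ _))//; apply: ler_sum => i _.
rewrite Normc.normcM E ler_wpM2l ?divr_ge0 ?exprn_ge0 ?normc_ge0//.
rewrite (le_trans (normc_sum _ _ _))//; apply: ler_sum => j _.
by rewrite E.
Qed.

Lemma cvg_exp_psum (x : R) : exp_psum N x @[N --> \oo] --> expR x.
Proof. exact: (@is_cvg_series_exp_coeff R x). Qed.

Lemma exp_psum_le_expR N (x : R) : 0 <= x -> exp_psum N x <= expR x.
Proof.
move=> x0; rewrite /expR; apply: nondecreasing_cvgn_le.
  apply/nondecreasing_seqP => n; rewrite /series/= big_nat_recr//= lerDl.
  exact: exp_coeff_ge0.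
exact: is_cvg_series_exp_coeff.
Qed.

Lemma cvg_exp_psum_im (y : R) :
  normc (exp_psum N (y *i) - (cos y +i* sin y)) @[N --> \oo] --> (0 : R).
Proof.
have hc : series (cos_coeff y) N @[N --> \oo] --> cos y.
  by rewrite unlock; exact: is_cvg_series_cos_coeff.
have hs : series (sin_coeff y) N @[N --> \oo] --> sin y.
  by rewrite unlock; exact: is_cvg_series_sin_coeff.
have E N : exp_psum N (y *i) = series (cos_coeff y) N +i* series (sin_coeff y) N.
  elim: N => [|N IH]; first by rewrite /exp_psum /series /= !big_geq.
  rewrite exp_psumS IH /series /= !big_nat_recr//=.
  have -> : (y *i ^+ N / N`!%:R : R[i]) = cos_coeff y N +i* sin_coeff y N.
    have yE : y *i = y%:C * 'i%C by simpc.
    have iE : ('i%C : R[i]) ^+ N = ((~~ odd N)%:R * (-1) ^+ N./2) +i* ((odd N)%:R * (-1) ^+ N.-1./2).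
      rewrite -{1}[N]odd_double_half -mul2n exprD exprM sqr_i.
      have -> : ((-1) ^+ N./2 : R[i]) = ((-1) ^+ N./2)%:C.
        by rewrite rmorphXn/= rmorphN rmorph1.
      case: N {IH} => [|N]/=; first by simpc.
      by rewrite uphalf_half; case: (odd N); rewrite /= ?expr0 ?expr1; simpc.
    rewrite yE exprMn iE -(rmorph_nat (real_complex R)) -fmorphV -rmorphXn/= /cos_coeff /sin_coeff/=.
    by simpc; rewrite -!exprnP; congr (_ +i* _); ring.
  by simpc.
have /(_ _) h1 : `|series (cos_coeff y) N - cos y| + `|series (sin_coeff y) N - sin y| @[N --> \oo] --> (0 : R).
  rewrite -[X in _ --> X]addr0; by apply: cvgD; exact: cvg_norm_sub0.
apply: (squeeze_cvg0 _ h1) => N; rewrite normc_ge0/= E.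
by rewrite (le_trans (normc_le_ReIm _)).
Qed.

(** For [z = x + iy] the [N]-th partial sum differs from the product of those at
    [x] and [iy] by a term that tends to 0; the first factor converges to
    [expR x], and the second to [cos y + i sin y] by the real series of cosine
    and sine. *)
Lemma cexp_series z : pser_cvg (fun n => (n`!%:R)^-1) z (cexp z).
Proof.
set x := complex.Re z; set y := complex.Im z.
suff h : normc (exp_psum N z - cexp z) @[N --> \oo] --> (0 : R).
  rewrite /pser_cvg; under eq_fun do under eq_bigr do rewrite mulrC.
  exact: h.
have zE : z = x%:C + y *i by case: (z) @x @y => a b /=; simpc.
have hx := @cvg_exp_psum x; have hy := @cvg_exp_psum_im y.
pose A N := exp_psum N `|x| * exp_psum N `|y| - exp_psum N (`|x| + `|y|).
pose B N := exp_psum N `|x| * normc (exp_psum N (y *i) - (cos y +i* sin y)).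
pose D N := `|exp_psum N x - expR x|.
have h : A N + (B N + D N) @[N --> \oo] --> (0 : R).
  have hA : A N @[N --> \oo] --> (0 : R).
    rewrite -(subrr (expR (`|x| + `|y|))) {1}expRD.
    by apply: cvgB; [apply: cvgM|]; exact: cvg_exp_psum.
  have hB : B N @[N --> \oo] --> (0 : R).
    by rewrite -(mulr0 (expR `|x|)); apply: cvgM => //; exact: cvg_exp_psum.
  have hD : D N @[N --> \oo] --> (0 : R).
    exact: cvg_norm_sub0.
  by rewrite -[X in _ --> X]addr0; apply: cvgD => //; rewrite -[X in _ --> X]addr0; apply: cvgD.
apply: (squeeze_cvg0 _ h) => N; rewrite normc_ge0/=.
have -> : exp_psum N z - cexp z =
  - (exp_psum N x%:C * exp_psum N (y *i) - exp_psum N (x%:C + y *i)) +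
  (exp_psum N x%:C * (exp_psum N (y *i) - (cos y +i* sin y)) +
   (exp_psum N x - expR x)%:C * (cos y +i* sin y)).
  rewrite -zE /cexp -/x -/y exp_psum_real rmorphB/=; ring.
rewrite (le_trans (normcD _ _))// lerD//.
  rewrite normcNE (le_trans (exp_psum_prodB_le _ _ _))// normc_real.
  by rewrite (_ : normc (y *i) = `|y|)// /normc expr0n /= add0r sqrtr_sqr.
rewrite (le_trans (normcD _ _))// lerD//.
  rewrite Normc.normcM ler_wpM2r ?normc_ge0//.
  by rewrite (le_trans (exp_psum_normc_le _ _))// normc_real.
by rewrite Normc.normcM normc_real /normc cos2Dsin2 sqrtr1 mulr1.
Qed.

End ComplexExp.

(** * Complex integrals and analyticity of Laplace integrals *)

Section ComplexIntegral.
Context d (T : measurableType d) (R : realType) (mu : {measure set T -> \bar R}).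
Variables (D : set T) (mD : measurable D).
Implicit Types (f g : T -> R[i]).
Local Open Scope complex_scope.
Local Notation normc := Normc.normc.

Definition cmeasurable f : Prop :=
  measurable_fun D (@complex.Re R \o f) /\ measurable_fun D (@complex.Im R \o f).

Definition cint f : R[i] :=
  (\int[mu]_(x in D) complex.Re (f x)) +i* (\int[mu]_(x in D) complex.Im (f x)).

Definition cintegrable f : Prop :=
  mu.-integrable D (EFin \o (@complex.Re R \o f)) /\
  mu.-integrable D (EFin \o (@complex.Im R \o f)).

Lemma cmeasurableM f g : cmeasurable f -> cmeasurable g ->
  cmeasurable (fun x => f x * g x).
Proof.
move=> [f1 f2] [g1 g2]; split.
  rewrite (_ : _ \o _ = (fun x => complex.Re (f x) * complex.Re (g x) - complex.Im (f x) * complex.Im (g x))).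
    by apply: measurable_funB; exact: measurable_funM.
  by apply/funext => x /=; rewrite cReM.
rewrite (_ : _ \o _ = (fun x => complex.Re (f x) * complex.Im (g x) + complex.Im (f x) * complex.Re (g x))).
  by apply: measurable_funD; exact: measurable_funM.
by apply/funext => x /=; rewrite cImM.
Qed.

Lemma cmeasurable_real (h : T -> R) : measurable_fun D h -> cmeasurable (fun x => (h x)%:C).
Proof. by move=> mh; split => //; exact: measurable_cst. Qed.

Lemma cmeasurable_cst (k : R[i]) : cmeasurable (fun=> k).
Proof. by split; exact: measurable_cst. Qed.

Lemma cmeasurableX f n : cmeasurable f -> cmeasurable (fun x => f x ^+ n).
Proof.
move=> mf; elim: n => [|n IH]; first exact: cmeasurable_cst.
by under eq_fun do rewrite exprS; exact: cmeasurableM.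
Qed.

Lemma cmeasurable_cexp (a : R[i]) (h : T -> R) : measurable_fun D h ->
  cmeasurable (fun x => cexp (a * (h x)%:C)).
Proof.
move=> mh; apply: cmeasurableM.
  apply/cmeasurable_real/measurableT_comp => //.
  under eq_fun do rewrite cReM/= mulr0 subr0.
  exact: measurable_funM.
have mI : measurable_fun D (fun x => complex.Im (a * (h x)%:C)).
  by under eq_fun do rewrite cImM/= mulr0 add0r; exact: measurable_funM.
split; rewrite /comp /=; apply: measurableT_comp => //; apply: continuous_measurable_fun.
  exact: continuous_cos.
exact: continuous_sin.
Qed.

Lemma cintegrable_le f (h : T -> R) : cmeasurable f ->
  mu.-integrable D (EFin \o h) -> (forall x, D x -> normc (f x) <= h x) ->
  cintegrable f.
Proof.
move=> [m1 m2] ih fh; split; apply: (le_integrable mD _ _ ih) => //=.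
- exact/measurable_EFinP.
- move=> x Dx; rewrite lee_fin (le_trans (ler_Re_normc _))// (le_trans (fh x Dx))//.
  exact: ler_norm.
- exact/measurable_EFinP.
- move=> x Dx; rewrite lee_fin (le_trans (ler_Im_normc _))// (le_trans (fh x Dx))//.
  exact: ler_norm.
Qed.

Lemma cintegrableD f g : cintegrable f -> cintegrable g -> cintegrable (fun x => f x + g x).
Proof.
move=> [f1 f2] [g1 g2]; split.
  rewrite (_ : _ \o _ = (EFin \o (@complex.Re R \o f)) \+ (EFin \o (@complex.Re R \o g)))%E.
    exact: integrableD.
  by apply/funext => x /=; rewrite cReD EFinD.
rewrite (_ : _ \o _ = (EFin \o (@complex.Im R \o f)) \+ (EFin \o (@complex.Im R \o g)))%E.
  exact: integrableD.
by apply/funext => x /=; rewrite cImD EFinD.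
Qed.

Lemma cintD f g : cintegrable f -> cintegrable g ->
  cint (fun x => f x + g x) = cint f + cint g.
Proof.
move=> [f1 f2] [g1 g2]; rewrite /cint; simpc; congr (_ +i* _).
  by rewrite -RintegralD//; apply: eq_Rintegral => x _; rewrite cReD.
by rewrite -RintegralD//; apply: eq_Rintegral => x _; rewrite cImD.
Qed.

Let integrableM (k : R) (h : T -> R) : mu.-integrable D (EFin \o h) ->
  mu.-integrable D (EFin \o (fun x => k * h x)).
Proof.
by move=> ih; have := integrableZl mD k ih; apply: eq_integrable => //.
Qed.

Lemma cintM (k : R[i]) f : cintegrable f ->
  cintegrable (fun x => k * f x) /\ cint (fun x => k * f x) = k * cint f.
Proof.
case: k => a b [f1 f2]; split.
  split.
    have := integrableB mD (integrableM a f1) (integrableM b f2).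
    by apply: eq_integrable => // x _; rewrite /= cReM EFinB.
  have := integrableD mD (integrableM a f2) (integrableM b f1).
  by apply: eq_integrable => // x _; rewrite /= cImM EFinD.
rewrite /cint; simpc; rewrite -!RintegralZl//; congr (_ +i* _).
  rewrite -RintegralB//; [|exact: integrableM|exact: integrableM].
  by apply: eq_Rintegral => x _; rewrite cReM.
rewrite -RintegralD//; [|exact: integrableM|exact: integrableM].
by apply: eq_Rintegral => x _; rewrite cImM.
Qed.

Lemma cint0 : cintegrable (fun=> 0) /\ cint (fun=> 0) = 0.
Proof.
split; first by split; exact: integrable0.
by rewrite /cint /= !Rintegral_cst// !mul0r.
Qed.

Lemma cint_sum (f : nat -> T -> R[i]) N : (forall n, cintegrable (f n)) ->
  cintegrable (fun x => \sum_(0 <= n < N) f n x) /\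
  cint (fun x => \sum_(0 <= n < N) f n x) = \sum_(0 <= n < N) cint (f n).
Proof.
move=> fi; elim: N => [|N [IH1 IH2]].
  under eq_fun do rewrite big_geq//.
  by rewrite big_geq//; exact: cint0.
under eq_fun do rewrite big_nat_recr//=.
by split; [exact: cintegrableD|rewrite cintD// IH2 big_nat_recr].
Qed.

Let dct_real (u : nat -> T -> R) (v h : T -> R) :
  (forall n, measurable_fun D (u n)) -> measurable_fun D v ->
  (forall x, D x -> u n x @[n --> \oo] --> v x) ->
  mu.-integrable D (EFin \o h) -> (forall n x, D x -> `|u n x| <= h x) ->
  \int[mu]_(x in D) u n x @[n --> \oo] --> \int[mu]_(x in D) v x.
Proof.
move=> mu_ mv uv ih uh.
have [] := @dominated_convergence _ _ _ mu D mD (fun n => EFin \o u n)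
  (EFin \o v) (EFin \o h).
- by move=> n; exact/measurable_EFinP.
- exact/measurable_EFinP.
- by apply: aeW => x Dx; apply: cvg_EFin; [exact: nearW|exact: uv].
- exact: ih.
- by apply: aeW => x n Dx; rewrite lee_fin uh.
move=> iv _ hc.
apply: fine_cvg; rewrite fineK//.
exact: integrable_fin_num.
Qed.

Lemma cint_dct (u : nat -> T -> R[i]) (v : T -> R[i]) (h : T -> R) :
  (forall n, cmeasurable (u n)) -> cmeasurable v ->
  (forall x, D x -> normc (u n x - v x) @[n --> \oo] --> (0 : R)) ->
  mu.-integrable D (EFin \o h) -> (forall n x, D x -> normc (u n x) <= h x) ->
  normc (cint (u n) - cint v) @[n --> \oo] --> (0 : R).
Proof.
move=> mu_ [mv1 mv2] uv ih uh.
have comp_cvg (p : R[i] -> R) : (forall z w, p (z - w) = p z - p w) ->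
    (forall z, `|p z| <= normc z) ->
    forall x, D x -> p (u n x) @[n --> \oo] --> p (v x).
  move=> pB pn x Dx; apply/subr_cvg0/norm_cvg0P.
  by apply: (squeeze_cvg0 _ (uv x Dx)) => n; rewrite normr_ge0 -pB pn.
have h1 := cvg_norm_sub0 (@dct_real (fun n => @complex.Re R \o u n) (@complex.Re R \o v) h (fun n => (mu_ n).1) mv1
  (comp_cvg _ (raddfB (@complex.Re R)) (@ler_Re_normc R)) ih
  (fun n x Dx => le_trans (ler_Re_normc _) (uh n x Dx))).
have h2 := cvg_norm_sub0 (@dct_real (fun n => @complex.Im R \o u n) (@complex.Im R \o v) h (fun n => (mu_ n).2) mv2
  (comp_cvg _ (raddfB (@complex.Im R)) (@ler_Im_normc R)) ih
  (fun n x Dx => le_trans (ler_Im_normc _) (uh n x Dx))).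
have /(_ _) h3 := cvgD h1 h2; rewrite addr0 in h3.
apply: (squeeze_cvg0 _ h3) => n; rewrite normc_ge0 andTb.
exact: (normc_le_ReIm (cint (u n) - cint v)).
Qed.

(** Expanding [exp ((s - a) l)] in powers of [s - a] and integrating term by term
    gives a power series at [a].  The integrability hypothesis is a majorant of
    all the partial sums on the disc of radius [r], since
    [exp_psum N (r * |l|) <= expR (r * |l|)]. *)
Lemma analytic_laplace (w l : T -> R) (a : R[i]) (r : R) :
  measurable_fun D w -> measurable_fun D l -> 0 < r ->
  mu.-integrable D (EFin \o (fun t => `|w t| * expR (complex.Re a * l t + r * `|l t|))) ->
  analytic_at (fun s => cint (fun t => (w t)%:C * cexp (s * (l t)%:C))) a.
Proof.
move=> mw ml r0; set h := fun t => _; move=> ih.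
have h0 t : 0 <= h t by rewrite mulr_ge0// expR_ge0.
pose u n t := (w t)%:C * cexp (a * (l t)%:C) * ((l t)%:C ^+ n / n`!%:R).
have fn (n : nat) : normc ((n`!%:R : R[i])^-1) = n`!%:R^-1.
  by rewrite Normc.normcV -(rmorph_nat (real_complex R)) normc_real normr_nat.
have ReA t : complex.Re (a * (l t)%:C) = complex.Re a * l t.
  by rewrite cReM/= mulr0 subr0.
have nw t : normc ((w t)%:C * cexp (a * (l t)%:C)) = `|w t| * expR (complex.Re a * l t).
  by rewrite Normc.normcM normc_real normc_cexp ReA.
have mu_ n : cmeasurable (u n).
  apply: cmeasurableM; apply: cmeasurableM.
  - exact: cmeasurable_real.
  - exact: cmeasurable_cexp.
  - by apply: cmeasurableX; exact: cmeasurable_real.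
  - exact: cmeasurable_cst.
have nu n t : normc (u n t) = `|w t| * expR (complex.Re a * l t) * (`|l t| ^+ n / n`!%:R).
  by rewrite /u Normc.normcM nw Normc.normcM normcX normc_real fn.
have psum_le N (q : R) t : 0 <= q <= r -> `|w t| * expR (complex.Re a * l t) * exp_psum N (q * `|l t|) <= h t.
  move=> /andP[q0 qr]; rewrite -mulrA ler_wpM2l// expRD ler_wpM2l ?expR_ge0//.
  rewrite (le_trans (exp_psum_le_expR _ _)) ?mulr_ge0// ler_expR.
  exact: ler_wpM2r.
have iu n : cintegrable (u n).
  apply: (@cintegrable_le _ (fun t => (r ^+ n)^-1 * h t)) => //.
    by have := integrableZl mD (r ^+ n)^-1 ih; apply: eq_integrable.
  move=> t _; rewrite nu [leRHS]mulrC ler_pdivlMr ?exprn_gt0//.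
  have rr : 0 <= r <= r by rewrite lexx (ltW r0).
  apply: (le_trans _ (psum_le n.+1 r t rr)); rewrite -[leLHS]mulrA ler_wpM2l ?mulr_ge0 ?expR_ge0//.
  rewrite exp_psumS exprMn mulrAC [r ^+ n * _]mulrC lerDr.
  by apply: sumr_ge0 => i _; rewrite divr_ge0// exprn_ge0// mulr_ge0// ltW.
apply/analytic_atP; exists (fun n => cint (u n)), r; split => // z zr.
have sumE N : \sum_(0 <= n < N) cint (u n) * z ^+ n = cint (fun t =>
    (w t)%:C * cexp (a * (l t)%:C) * exp_psum N (z * (l t)%:C)).
  have iuz n := cintM (z ^+ n) (iu n).
  under eq_bigr do rewrite mulrC -(iuz _).2.
  rewrite -(cint_sum N (fun n => (iuz n).1)).2; congr cint; apply/funext => t.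
  rewrite /exp_psum mulr_sumr; apply: eq_bigr => i _; rewrite /u exprMn; ring.
rewrite /pser_cvg; under eq_fun do rewrite sumE.
have mU N : cmeasurable (fun t => (w t)%:C * cexp (a * (l t)%:C) * exp_psum N (z * (l t)%:C)).
  apply: cmeasurableM; first by apply: cmeasurableM; [exact: cmeasurable_real|exact: cmeasurable_cexp].
  elim: N => [|N IH]; first by rewrite /exp_psum; under eq_fun do rewrite big_geq//; exact: cmeasurable_cst.
  under eq_fun do rewrite exp_psumS.
  have [a1 a2] := IH.
  have [b1 b2] : cmeasurable (fun t => (z * (l t)%:C) ^+ N / N`!%:R).
    apply: cmeasurableM; last exact: cmeasurable_cst.
    by apply: cmeasurableX; apply: cmeasurableM; [exact: cmeasurable_cst|exact: cmeasurable_real].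
  split; rewrite /comp /=; first by under eq_fun do rewrite cReD; exact: measurable_funD.
  by under eq_fun do rewrite cImD; exact: measurable_funD.
apply: (@cint_dct _ _ h) => //.
- apply: cmeasurableM; first exact: cmeasurable_real.
  exact: cmeasurable_cexp.
- move=> t Dt; have := @cexp_series R (z * (l t)%:C); rewrite /pser_cvg => hs.
  set W := (w t)%:C * cexp (a * (l t)%:C).
  have h1 : normc W * normc (\sum_(0 <= n < N) n`!%:R^-1 * (z * (l t)%:C) ^+ n - cexp (z * (l t)%:C)) @[N --> \oo] --> (0 : R).
    by rewrite -(mulr0 (normc W)); apply: cvgM; [exact: cvg_cst|exact: hs].
  apply: (squeeze_cvg0 _ h1) => N; rewrite normc_ge0 andTb -Normc.normcM.
  rewrite mulrDl cexpD mulrA -mulrBr.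
  rewrite [X in _ <= normc (_ * (X - _))](_ : _ = exp_psum N (z * (l t)%:C))//.
  by rewrite /exp_psum; apply: eq_bigr => i _; rewrite mulrC.
- move=> N t _; rewrite Normc.normcM nw.
  have zz : 0 <= normc z <= r by rewrite normc_ge0 ltW.
  apply: (le_trans _ (psum_le N _ t zz)); rewrite ler_wpM2l ?mulr_ge0 ?expR_ge0//.
  by rewrite (le_trans (exp_psum_normc_le _ _))// Normc.normcM normc_real.
Qed.

End ComplexIntegral.

(** * The completed Lebesgue measure *)

Section LebTransfer.
Variable R : realType.
Local Notation cara := (caratheodory_type (wlength (R := R) idfun)^*%mu).
Local Notation mu := (@lebesgue_measure R).

Lemma cara_measurable (A : set R) :
  measurable (A : set (measurableTypeR R)) -> measurable (A : set cara).
Proof. by move=> mA; apply: sub_caratheodory. Qed.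

Lemma cara_measurable_fun d (T : measurableType d) (D : set R) (f : R -> T) :
  measurable D -> measurable_fun (D : set (measurableTypeR R)) f ->
  measurable_fun (D : set cara) f.
Proof. by move=> mD mf _ B mB; apply: cara_measurable; exact: mf. Qed.

(** The identity is measurable from the completed sigma-algebra to the Borel one,
    and the completed measure pushes forward to the Borel measure along it.  This
    gives access to the fundamental theorem of calculus. *)
Lemma ge0_integral_leb (D : set R) (f : R -> \bar R) :
  measurable (D : set (measurableTypeR R)) ->
  measurable_fun (D : set (measurableTypeR R)) f ->
  (forall x, D x -> (0 <= f x)%E) ->
  (\int[leb]_(x in D) f x = \int[mu]_(x in D) f x)%E.
Proof.
move=> mD mf f0.
have mid : measurable_fun [set: cara] (idfun : cara -> measurableTypeR R).
  by move=> _ B mB; rewrite setTI; exact: cara_measurable.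
have := @ge0_integral_pushforward _ _ _ _ R _ mid (@completed_lebesgue_measure R) D f mD mf.
rewrite preimage_id.
move=> <-; first exact: eq_measure_integral.
by move=> x; rewrite inE; exact: f0.
Qed.

End LebTransfer.

(** * Fractional parts and power functions *)

Section Fracpart.
Variable R : realType.
Implicit Types x y : R.

Lemma fracpart_ge0 y : 0 <= fracpart y.
Proof. by rewrite /fracpart subr_ge0 ge_floor. Qed.

Lemma fracpart_lt1 y : fracpart y < 1.
Proof. by rewrite /fracpart ltrBlDr addrC -[1]/(1%:~R) -intrD floorD1_gt. Qed.

Lemma fracpart_le y : 0 <= y -> fracpart y <= y.
Proof. by move=> y0; rewrite /fracpart gerBl ler0z floor_ge0. Qed.

Lemma fracpart_id y : 0 <= y < 1 -> fracpart y = y.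
Proof. by move=> /andP[y0 y1]; rewrite /fracpart (@floor_def _ _ 0) ?subr0// y0. Qed.

Lemma measurable_fracpart : measurable_fun [set: R] (@fracpart R).
Proof.
apply: measurable_funB => //; apply: nondecreasing_measurable => //.
by move=> x y xy; rewrite ler_int; exact: le_floor.
Qed.

Lemma measurable_inv : measurable_fun [set: R] (@GRing.inv R).
Proof.
(* The inverse is not continuous at 0, but it is the product of the sign and a
   power of the absolute value. *)
have -> : @GRing.inv R = (fun x => Num.sg x * `|x| `^ (-1)).
  apply/funext => x; rewrite powR_inv1//.
  have [->|x0] := eqVneq x 0; first by rewrite invr0 sgr0 mul0r.
  rewrite {1}[x]numEsg invfM; congr (_ * _).
  by case: sgrP => _; rewrite ?invr0 ?invr1 ?invrN1.
apply: measurable_funM.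
  apply: nondecreasing_measurable => // x y; rewrite /Num.sg.
  by case: (ltrgt0P x) => x0; case: (ltrgt0P y) => y0 //=; rewrite ?ler01 ?lerN10 ?lexx//; lra.
by apply: (@measurableT_comp _ _ _ _ _ _ (fun y : R => y `^ (-1)) _ (fun x : R => `|x|)).
Qed.

End Fracpart.

Section PowerIntegrals.
Variable R : realType.
Local Notation cara := (caratheodory_type (wlength (R := R) idfun)^*%mu).
Local Notation mu := (@lebesgue_measure R).

Lemma measurable_powRe (D : set R) (p : R) :
  measurable_fun (D : set (measurableTypeR R)) (fun t : R => t `^ p).
Proof. by apply: measurable_funTS; exact: measurable_powR. Qed.

Let dF (p t : R) : p != 0 -> 0 < t -> is_derive t 1 (fun t => t `^ p / p) (t `^ (p - 1)).
Proof.
move=> p0 t0; have -> : (fun t => t `^ p / p) = p^-1 \*: (fun t : R => t `^ p).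
  by apply/funext => u; rewrite /= mulrC.
apply: is_derive_eq; first exact: (is_deriveZ p^-1 (is_derive1_powR p t0)).
by rewrite /GRing.scale /= mulrA mulVf// mul1r.
Qed.

Lemma continuous_powR_pos (p t : R) : 0 < t -> {for t, continuous (fun t : R => t `^ p)}.
Proof.
move=> t0; apply/differentiable_continuous/derivable1_diffP.
by apply: derivable_powR; rewrite in_itv/= t0.
Qed.

Let cF (p t : R) : p != 0 -> 0 < t -> {for t, continuous (fun t => t `^ p / p)}.
Proof.
move=> p0 t0; apply/differentiable_continuous/derivable1_diffP.
by apply: ex_derive; exact: dF.
Qed.

Lemma cvg_powR_pinfty (p : R) : p < 0 -> t `^ p @[t --> +oo] --> 0.
Proof.
move=> p0; apply/cvgrPdist_lt => e e0.
have q0 : 0 < - p by rewrite oppr_gt0.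
near=> t; rewrite sub0r normrN ger0_norm ?powR_ge0//.
have t0 : 0 < t by near: t; exact: nbhs_pinfty_gt.
have : (e^-1) `^ (- p)^-1 < t by near: t; apply: nbhs_pinfty_gt; rewrite num_real.
move/(gt0_ltr_powR q0); rewrite !nnegrE powR_ge0 (ltW t0) => /(_ isT isT).
rewrite -powRrM mulVf ?gt_eqF// powRr1 ?invr_ge0 ?ltW// powRN.
by rewrite ltf_pV2 ?posrE// powR_gt0.
Unshelve. all: by end_near. Qed.

Lemma integral_powR_oc (a b p : R) : 0 < a -> a < b -> p != 0 ->
  (\int[leb]_(t in `]a, b]) (t `^ (p - 1))%:E = ((b `^ p - a `^ p) / p)%:E)%E.
Proof.
move=> a0 ab p0.
have mf := @measurable_powRe `]a, b] (p - 1).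
rewrite ge0_integral_leb//; first last.
- by move=> t _; rewrite lee_fin powR_ge0.
- exact/measurable_EFinP.
rewrite integral_itv_obnd_cbnd; last first.
  by apply/measurable_EFinP; exact: measurable_powRe.
rewrite (@continuous_FTC2 _ _ (fun t => t `^ p / p))//.
- by rewrite -EFinB mulrBl.
- apply: continuous_in_subspaceT => t; rewrite inE/= in_itv/= => /andP[at_ _].
  exact/continuous_powR_pos/(lt_le_trans a0).
- split.
  + move=> t; rewrite in_itv/= => /andP[at_ _].
    by apply: ex_derive; apply: dF => //; exact: lt_trans at_.
  + by apply: cvg_at_right_filter; exact: cF.
  + by apply: cvg_at_left_filter; apply: cF => //; exact: lt_trans ab.
- move=> t; rewrite in_itv/= => /andP[at_ _].
  by rewrite derive1E; apply: derive_val; apply: dF => //; exact: lt_trans at_.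
Qed.

Lemma integral_powR_y (a p : R) : 0 < a -> p < 0 ->
  (\int[leb]_(t in `]a, +oo[) (t `^ (p - 1))%:E = (a `^ p / - p)%:E)%E.
Proof.
move=> a0 p0.
have mf := @measurable_powRe `]a, +oo[ (p - 1).
rewrite ge0_integral_leb//; first last.
- by move=> t _; rewrite lee_fin powR_ge0.
- exact/measurable_EFinP.
rewrite integral_itv_obnd_cbnd; last first.
  by apply/measurable_EFinP; exact: measurable_powRe.
rewrite (@ge0_continuous_FTC2y _ _ (fun t => t `^ p / p) a 0)//.
- by rewrite -EFinB sub0r invrN mulrN.
- by move=> t _; exact: powR_ge0.
- apply: continuous_in_subspaceT => t; rewrite inE/= in_itv/= andbT => at_.
  exact/continuous_powR_pos/(lt_le_trans a0).
- by rewrite -(mul0r p^-1); apply: cvgM; [exact: cvg_powR_pinfty|exact: cvg_cst].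
- move=> t at_; apply: ex_derive; apply: dF; first by rewrite lt_eqF.
  exact: lt_trans at_.
- by apply: cvg_at_right_filter; apply: cF => //; rewrite lt_eqF.
- move=> t; rewrite in_itv/= andbT => at_.
  by rewrite derive1E; apply: derive_val; apply: dF; [rewrite lt_eqF|exact: lt_trans at_].
Qed.

(** The set of the [t > 0] for which the integer part of [x / t] is [k.+1]. *)
Definition hyperb_piece (x : R) (k : nat) : set R := `]x / k.+2%:R, x / k.+1%:R]%classic.

Lemma measurable_hyperb_piece (x : R) k : measurable (hyperb_piece x k : set cara).
Proof. by apply: cara_measurable; exact: measurable_itv. Qed.

Lemma hyperb_pieceP (x t : R) k : 0 < x ->
  hyperb_piece x k t <-> 0 < t /\ k.+1%:R <= x / t < k.+2%:R.
Proof.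
move=> x0; rewrite /hyperb_piece/= in_itv/=; split=> [/andP[h1 h2]|[t0 /andP[h1 h2]]].
  have t0 : 0 < t by apply: le_lt_trans h1; rewrite divr_ge0// ltW.
  by split=> //; rewrite ler_pdivlMr// ltr_pdivrMr// mulrC -ler_pdivlMr// h2 mulrC -ltr_pdivrMr.
by rewrite ltr_pdivrMr// ler_pdivlMr// mulrC -ltr_pdivrMr// h2 mulrC -ler_pdivlMr.
Qed.

Lemma fracpart_piece (x t : R) k : 0 < x -> hyperb_piece x k t ->
  fracpart (x / t) = x / t - k.+1%:R.
Proof.
move=> x0 /(hyperb_pieceP _ _ x0)[t0 h]; rewrite /fracpart; congr (_ - _).
rewrite (@floor_def _ _ k.+1%:Z)//.
by move: h; rewrite intrD -[k.+2%:R]natr1.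
Qed.

Lemma bigcup_hyperb_piece (x : R) : 0 < x -> \bigcup_k hyperb_piece x k = `]0, x]%classic.
Proof.
move=> x0; apply/seteqP; split=> [t [k _ /(hyperb_pieceP _ _ x0)[t0 /andP[h _]]]|t /=].
  rewrite /= in_itv/= t0/= -(mul1r t) -ler_pdivlMr// (le_trans _ h)//.
  by rewrite ler1n.
rewrite in_itv/= => /andP[t0 tx].
have xt1 : 1 <= x / t by rewrite ler_pdivlMr// mul1r.
exists (Num.truncn (x / t)).-1 => //; apply/hyperb_pieceP => //; split=> //.
have /andP[h1 h2] := truncn_itv (le_trans ler01 xt1).
have n0 : (0 < Num.truncn (x / t))%N by rewrite truncn_gt0.
by rewrite prednK// h1.
Qed.

Lemma trivIset_hyperb_piece (x : R) : 0 < x -> trivIset setT (hyperb_piece x).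
Proof.
move=> x0; apply/trivIsetP => i j _ _ ij; apply/seteqP; split=> // t [].
move=> /(hyperb_pieceP _ _ x0)[t0 /andP[h1 h2]] /(hyperb_pieceP _ _ x0)[_ /andP[h3 h4]].
move/negP: ij; apply; apply/eqP.
have := le_lt_trans h1 h4; have := le_lt_trans h3 h2; rewrite !ltr_nat !ltnS => a b.
by apply/eqP; rewrite eqn_leq a b.
Qed.

Lemma integral_hyperb_pieces (x L : R) (f : R -> R) (G : nat -> R) : 0 < x ->
  measurable_fun (`]0, x] : set cara) f ->
  (forall t, 0 < t -> 0 <= f t) ->
  (forall k, (\int[leb]_(t in hyperb_piece x k) (f t)%:E = (G k)%:E)%E) ->
  \sum_(0 <= k < n) G k @[n --> \oo] --> L ->
  (\int[leb]_(t in `]0%R, x]) (f t)%:E = L%:E)%E.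
Proof.
move=> x0 mf f0 fG GL.
rewrite -bigcup_hyperb_piece// ge0_integral_bigcup//=.
- under eq_eseriesr do rewrite fG.
  apply/cvg_lim => //.
  under eq_fun do rewrite sumEFin.
  by apply: cvg_EFin GL; exact: nearW.
- by move=> k; exact: measurable_hyperb_piece.
- by rewrite [X in measurable_fun X]bigcup_hyperb_piece//; exact/measurable_EFinP.
- by move=> t [k _ /(hyperb_pieceP _ _ x0)[t0 _]]; rewrite lee_fin f0.
- exact: trivIset_hyperb_piece.
Qed.

Lemma cvg_powR_nat (p : R) : p < 0 -> n.+1%:R `^ p @[n --> \oo] --> (0 : R).
Proof.
move=> p0; have /cvg_pinftyP := cvg_powR_pinfty p0; apply.
apply/cvgryPge => A; near=> n; rewrite (@le_trans _ _ n%:R) ?ler_nat//.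
by near: n; exact: nbhs_infty_ger.
Unshelve. all: by end_near. Qed.

Lemma powR_div_nat (x p : R) n : 0 < x ->
  (x / n.+1%:R) `^ p = x `^ p * n.+1%:R `^ (- p).
Proof.
move=> x0; rewrite powRM ?invr_ge0// ?(ltW x0)// -powR_inv1// -powRrM.
by rewrite mulN1r.
Qed.

Lemma integral_powR_piece (x p : R) k : 0 < x -> p != 0 ->
  (\int[leb]_(t in hyperb_piece x k) (t `^ (p - 1))%:E =
  ((x / k.+1%:R) `^ p / p - (x / k.+2%:R) `^ p / p)%:E)%E.
Proof.
move=> x0 p0; rewrite integral_powR_oc ?mulrBl//; first by rewrite divr_gt0.
by rewrite ltr_pM2l// ltf_pV2 ?posrE// ltr_nat.
Qed.

Lemma cvg_telescope_powR (x p : R) : 0 < x -> 0 < p ->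
  \sum_(0 <= k < n) ((x / k.+1%:R) `^ p / p - (x / k.+2%:R) `^ p / p) @[n --> \oo]
    --> x `^ p / p.
Proof.
move=> x0 p0.
have E n : \sum_(0 <= k < n) ((x / k.+1%:R) `^ p / p - (x / k.+2%:R) `^ p / p) =
    x `^ p / p - x `^ p * n.+1%:R `^ (- p) / p.
  elim: n => [|n IH]; first by rewrite big_geq// powR1 mulr1 subrr.
  by rewrite big_nat_recr//= IH !powR_div_nat//; ring.
under eq_fun do rewrite E.
suff : x `^ p / p - x `^ p * n.+1%:R `^ (- p) / p @[n --> \oo] --> x `^ p / p - x `^ p * 0 / p.
  by rewrite mulr0 mul0r subr0; apply.
apply: cvgB; first exact: cvg_cst.
apply: cvgM; last exact: cvg_cst.
apply: cvgM; first exact: cvg_cst.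
by apply: cvg_powR_nat; rewrite oppr_lt0.
Qed.

(** The primitive is not differentiable at 0, so the integral is summed over the
    pieces, where it telescopes. *)
Lemma integral_powR_0 (x p : R) : 0 < x -> 0 < p ->
  (\int[leb]_(t in `]0%R, x]) (t `^ (p - 1))%:E = (x `^ p / p)%:E)%E.
Proof.
move=> x0 p0; apply: (@integral_hyperb_pieces x _ _ _ x0) (cvg_telescope_powR x0 p0) => //.
- by apply: cara_measurable_fun => //; exact: measurable_powRe.
- by move=> t _; exact: powR_ge0.
- by move=> k; rewrite integral_powR_piece// gt_eqF.
Qed.

Lemma abel_sum (a : nat -> R) n :
  \sum_(0 <= k < n) k.+1%:R * (a k - a k.+1) = \sum_(0 <= k < n) a k - n%:R * a n.
Proof.
elim: n => [|n IH]; first by rewrite !big_geq// mul0r subrr.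
by rewrite !big_nat_recr//= IH -natr1; ring.
Qed.

Lemma measurable_fracpart_div (D : set R) (x : R) : measurable D ->
  measurable_fun (D : set (measurableTypeR R)) (fun t : R => fracpart (x / t)).
Proof.
move=> mD; apply: measurable_funTS.
apply: (@measurableT_comp _ _ _ _ _ _ (@fracpart R) _ (fun t : R => x / t)).
  exact: measurable_fracpart.
by apply: measurable_funM => //; exact: measurable_inv.
Qed.

(** On the [k]-th piece the integrand is [x t^(s-2) - (k+1) t^(s-1)], whose
    integral is explicit.  The sum of the first terms telescopes, and a summation
    by parts turns that of the second ones into [x^s / s] times the partial sum
    of zeta at [s], up to a boundary term of order [n^(1-s)]. *)
Lemma integral_fracpart_powR (x s z : R) : 0 < x -> 1 < s ->
  \sum_(0 <= k < n) k.+1%:R `^ (- s) @[n --> \oo] --> z ->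
  (\int[leb]_(t in `]0%R, x]) (fracpart (x / t) * t `^ (s - 1))%:E =
   (x `^ s * ((s - 1)^-1 - z / s))%:E)%E.
Proof.
move=> x0 s1 hz.
have s0 : 0 < s by rewrite (lt_trans _ s1).
have s10 : 0 < s - 1 by rewrite subr_gt0.
pose a p k : R := (x / k.+1%:R) `^ p / p.
apply: (@integral_hyperb_pieces x _ _ (fun k => x * (a (s - 1) k - a (s - 1) k.+1) - k.+1%:R * (a s k - a s k.+1)) x0).
- apply: cara_measurable_fun => //; apply: measurable_funM; first exact: measurable_fracpart_div.
  exact: measurable_powRe.
- by move=> t _; apply: mulr_ge0; [exact: fracpart_ge0|exact: powR_ge0].
- move=> k.
  have mp := measurable_hyperb_piece x k.
  have ip p : p != 0 -> (@completed_lebesgue_measure R).-integrable (hyperb_piece x k) (EFin \o (fun t : R => t `^ (p - 1))).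
    move=> p0; apply/integrableP; split.
      apply/measurable_EFinP; apply: cara_measurable_fun; last exact: measurable_powRe.
      exact: measurable_itv.
    under eq_integral => t do rewrite /= ger0_norm ?powR_ge0//.
    by rewrite integral_powR_piece// ltry.
  transitivity (\int[leb]_(t in hyperb_piece x k) (x%:E * (t `^ (s - 1 - 1))%:E - k.+1%:R%:E * (t `^ (s - 1))%:E))%E.
    apply: eq_integral => t; rewrite inE => tk; rewrite (fracpart_piece x0 tk).
    have [t0 _] := (hyperb_pieceP _ _ x0).1 tk.
    rewrite -!EFinM -EFinB; congr EFin; rewrite mulrBl; congr (_ - _).
    by rewrite -(mulr_powRB1 (ltW t0) s10) mulrA mulfVK// gt_eqF.
  rewrite integralB//; first last.
  - by apply: integrableZl => //; apply: ip; rewrite gt_eqF.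
  - by apply: integrableZl => //; apply: ip; rewrite gt_eqF.
  rewrite !integralZl//; first last.
  - by apply: ip; rewrite gt_eqF.
  - by apply: ip; rewrite gt_eqF.
  by rewrite !integral_powR_piece ?gt_eqF// EFinB !EFinM.
have E n : \sum_(0 <= k < n) (x * (a (s - 1) k - a (s - 1) k.+1) - k.+1%:R * (a s k - a s k.+1)) =
    x * \sum_(0 <= k < n) (a (s - 1) k - a (s - 1) k.+1) -
    (x `^ s / s * (\sum_(0 <= k < n) k.+1%:R `^ (- s)) - n%:R * a s n).
  rewrite sumrB -mulr_sumr abel_sum; congr (_ - (_ - _)).
  by rewrite mulr_sumr; apply: eq_bigr => k _; rewrite /a powR_div_nat// mulrAC.
under eq_fun do rewrite E.
rewrite (_ : x `^ s * _ = x * (x `^ (s - 1) / (s - 1)) - (x `^ s / s * z - 0)); last first.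
  by rewrite subr0 mulrBr mulrA mulr_powRB1 ?ltW//; ring.
apply: cvgB.
  by apply: cvgM; [exact: cvg_cst|exact: cvg_telescope_powR].
apply: cvgB; first by apply: cvgM => //; exact: cvg_cst.
have h : x `^ s / s * n.+1%:R `^ (1 - s) @[n --> \oo] --> (0 : R).
  rewrite -(mulr0 (x `^ s / s)); apply: cvgM; first exact: cvg_cst.
  by apply: cvg_powR_nat; rewrite subr_lt0.
apply: (squeeze_cvg0 _ h) => n; apply/andP; split.
  by rewrite mulr_ge0// divr_ge0 ?powR_ge0// ltW.
rewrite /a powR_div_nat// [x `^ s * _ / _]mulrAC mulrCA.
apply: ler_wpM2l; first by rewrite divr_ge0 ?powR_ge0// ltW.
rewrite powRD ?pnatr_eq0 ?implybT// powRr1// ler_wpM2r ?powR_ge0//.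
by rewrite ler_nat.
Qed.

End PowerIntegrals.

(** * The Mellin transform of the fractional part kernel *)

Lemma integrable_setU_disjoint d (T : measurableType d) (R : realType)
    (mu : {measure set T -> \bar R}) (A B : set T) (f : T -> \bar R) :
  measurable A -> measurable B -> [disjoint A & B] ->
  mu.-integrable A f -> mu.-integrable B f -> mu.-integrable (A `|` B) f.
Proof.
move=> mA mB AB /integrableP[mfA fA] /integrableP[mfB fB]; apply/integrableP.
have mf : measurable_fun (A `|` B) f by apply/measurable_funU.
split=> //; rewrite ge0_integral_setU//; last exact: measurableT_comp.
exact: lte_add_pinfty.
Qed.

Section Kernel.
Variable R : realType.
Local Open Scope complex_scope.
Local Notation normc := Normc.normc.
Local Notation cara := (caratheodory_type (wlength (R := R) idfun)^*%mu).
Local Notation leb := (@completed_lebesgue_measure R).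
Implicit Types (x t p q : R) (s a : R[i]).

(** With this weight and [mellin_log], the function [{x/t} t^(s-1)] is
    [x^s * mellin_weight x t * exp (s * mellin_log x t)], a Laplace integrand in
    [s] whose logarithm changes sign exactly at the cutting point [t = x]. *)
Definition mellin_weight x t : R := fracpart (x / t) / t.

Definition mellin_log x t : R := ln (t / x).

Lemma mellin_weight_ge0 x t : 0 < t -> 0 <= mellin_weight x t.
Proof. by move=> t0; rewrite divr_ge0 ?fracpart_ge0// ltW. Qed.

Lemma mellin_weight_expR x t q : 0 < x -> 0 < t ->
  mellin_weight x t * expR (q * mellin_log x t) =
  x `^ (- q) * (fracpart (x / t) * t `^ (q - 1)).
Proof.
move=> x0 t0; rewrite /mellin_weight /mellin_log lnM ?posrE ?invr_gt0// lnV ?posrE//.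
have tn : t != 0 by rewrite gt_eqF.
have xn : x != 0 by rewrite gt_eqF.
rewrite mulrDr expRD [t `^ _]powRB ?tn ?implybT// powRr1 ?ltW//.
rewrite /powR (negbTE tn) (negbTE xn) mulrN -mulNr; ring.
Qed.

Lemma measurable_mellin_weight (D : set R) x : measurable D ->
  measurable_fun (D : set cara) (mellin_weight x).
Proof.
move=> mD; apply: cara_measurable_fun => //; apply: measurable_funM.
  exact: measurable_fracpart_div.
by apply: measurable_funTS; exact: measurable_inv.
Qed.

Lemma measurable_mellin_log (D : set R) x : measurable D ->
  measurable_fun (D : set cara) (mellin_log x).
Proof.
move=> mD; apply: cara_measurable_fun => //; apply: measurable_funTS.
apply: (@measurableT_comp _ _ _ _ _ _ (@ln R) _ (fun t : R => t / x)).
  exact: measurable_ln.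
by apply: measurable_funM => //; exact: measurable_cst.
Qed.

Lemma itv_measurable (i : interval R) : measurable ([set` i] : set cara).
Proof. by apply: cara_measurable; exact: measurable_itv. Qed.

Lemma integrable_powR_0 x p : 0 < x -> 0 < p ->
  leb.-integrable `]0, x] (EFin \o (fun t => t `^ (p - 1))).
Proof.
move=> x0 p0; apply/integrableP; split.
  apply/measurable_EFinP; apply: cara_measurable_fun; last exact: measurable_powRe.
  exact: measurable_itv.
under eq_integral => t do rewrite /= ger0_norm ?powR_ge0//.
by rewrite integral_powR_0// ltry.
Qed.

Lemma integrable_powR_y x p : 0 < x -> p < 0 ->
  leb.-integrable `]x, +oo[ (EFin \o (fun t => t `^ (p - 1))).
Proof.
move=> x0 p0; apply/integrableP; split.
  apply/measurable_EFinP; apply: cara_measurable_fun; last exact: measurable_powRe.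
  exact: measurable_itv.
under eq_integral => t do rewrite /= ger0_norm ?powR_ge0//.
by rewrite integral_powR_y// ltry.
Qed.

Lemma integrable_mellin_weight0 x q : 0 < x -> 0 < q ->
  leb.-integrable `]0, x] (EFin \o (fun t => mellin_weight x t * expR (q * mellin_log x t))).
Proof.
move=> x0 q0; have := integrableZl (itv_measurable _) (x `^ (- q)) (integrable_powR_0 x0 q0).
apply: (le_integrable (itv_measurable _)).
  apply/measurable_EFinP/measurable_funM; first exact: measurable_mellin_weight.
  apply: measurableT_comp => //; apply: measurable_funM; first exact: measurable_cst.
  exact: measurable_mellin_log.
move=> t; rewrite /= in_itv/= => /andP[t0 _]; rewrite mellin_weight_expR// lee_fin.
rewrite !ger0_norm ?mulr_ge0 ?powR_ge0 ?fracpart_ge0//.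
by rewrite ler_wpM2l ?powR_ge0// ler_piMl ?powR_ge0// ltW// fracpart_lt1.
Qed.

Lemma mellin_weight_expRy x t q : 0 < x -> x < t ->
  mellin_weight x t * expR (q * mellin_log x t) = x `^ (1 - q) * t `^ (q - 1 - 1).
Proof.
move=> x0 xt; have t0 : 0 < t := lt_trans x0 xt.
rewrite mellin_weight_expR// fracpart_id; last first.
  by rewrite divr_ge0 ?ltW// ltr_pdivrMr// mul1r.
have tn : t != 0 by rewrite gt_eqF.
have xn : x != 0 by rewrite gt_eqF.
rewrite [t `^ (q - 1 - 1)]powRB ?tn ?implybT// [x `^ (1 - q)]powRD ?xn ?implybT//.
by rewrite !powRr1 ?ltW//; ring.
Qed.

Lemma integrable_mellin_weighty x q : 0 < x -> q < 1 ->
  leb.-integrable `]x, +oo[ (EFin \o (fun t => mellin_weight x t * expR (q * mellin_log x t))).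
Proof.
move=> x0 q1; have q10 : q - 1 < 0 by rewrite subr_lt0.
have := integrableZl (itv_measurable _) (x `^ (1 - q)) (integrable_powR_y x0 q10).
apply: eq_integrable; first exact: itv_measurable.
by move=> t; rewrite inE/= in_itv/= andbT => xt; rewrite mellin_weight_expRy.
Qed.

Definition mellin_near x s : R[i] :=
  cint leb `]0, x] (fun t => (mellin_weight x t)%:C * cexp (s * (mellin_log x t)%:C)).

Definition mellin_far x s : R[i] :=
  cint leb `]x, +oo[ (fun t => (mellin_weight x t)%:C * cexp (s * (mellin_log x t)%:C)).

(** On [t <= x] the logarithm is nonpositive, so a disc of radius [Re a / 2]
    costs half of the decay at 0, and what remains is still integrable. *)
Lemma analytic_mellin_near x a : 0 < x -> 0 < complex.Re a ->
  analytic_at (mellin_near x) a.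
Proof.
move=> x0 a0; have r0 : 0 < complex.Re a / 2 by rewrite divr_gt0.
apply: (analytic_laplace (itv_measurable _) _ _ r0).
- exact: measurable_mellin_weight.
- exact: measurable_mellin_log.
have := integrable_mellin_weight0 x0 r0.
apply: eq_integrable; first exact: itv_measurable.
move=> t; rewrite inE/= in_itv/= => /andP[t0 tx].
rewrite [`|mellin_weight _ _|]ger0_norm ?mellin_weight_ge0//; congr (_ * expR _)%:E.
rewrite ler0_norm; first by rewrite {2}[complex.Re a]splitr; ring.
by rewrite ln_le0// ler_pdivrMr// mul1r.
Qed.

Lemma analytic_mellin_far x a : 0 < x -> complex.Re a < 1 ->
  analytic_at (mellin_far x) a.
Proof.
move=> x0 a1; have r0 : 0 < (1 - complex.Re a) / 2 by rewrite divr_gt0// subr_gt0.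
have q1 : (1 + complex.Re a) / 2 < 1 by rewrite ltr_pdivrMr// mul1r; lra.
apply: (analytic_laplace (itv_measurable _) _ _ r0).
- exact: measurable_mellin_weight.
- exact: measurable_mellin_log.
have := integrable_mellin_weighty x0 q1.
apply: eq_integrable; first exact: itv_measurable.
move=> t; rewrite inE/= in_itv/= andbT => xt; have t0 : 0 < t := lt_trans x0 xt.
rewrite [`|mellin_weight _ _|]ger0_norm ?mellin_weight_ge0//; congr (_ * expR _)%:E.
rewrite ger0_norm; first by field.
by rewrite ln_ge0// ler_pdivlMr// mul1r ltW.
Qed.

Lemma cint_real (D : set R) (f : R -> R) (v : R) :
  (\int[leb]_(t in D) (f t)%:E = v%:E)%E ->
  cint leb D (fun t => (f t)%:C) = v%:C.
Proof.
move=> h; rewrite /cint /Rintegral h/=; congr (_ +i* _).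
by under eq_integral do rewrite /=; rewrite integral0.
Qed.

Lemma real_cexpM (w q l : R) : w%:C * cexp (q%:C * l%:C) = (w * expR (q * l))%:C.
Proof.
have -> : q%:C * l%:C = (q * l)%:C by rewrite rmorphM.
by rewrite cexp_real rmorphM.
Qed.

Lemma mellin_near_real x (q z : R) : 0 < x -> 1 < q ->
  \sum_(0 <= k < n) k.+1%:R `^ (- q) @[n --> \oo] --> z ->
  mellin_near x q%:C = ((q - 1)^-1 - z / q)%:C.
Proof.
move=> x0 q1 hz; have h := integral_fracpart_powR x0 q1 hz.
rewrite /mellin_near.
have -> : (fun t => (mellin_weight x t)%:C * cexp (q%:C * (mellin_log x t)%:C)) =
    (fun t => (mellin_weight x t * expR (q * mellin_log x t))%:C).
  by apply/funext => t; exact: real_cexpM.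
apply: cint_real.
transitivity (\int[leb]_(t in `]0%R, x]) ((x `^ (- q))%:E * (fracpart (x / t) * t `^ (q - 1))%:E))%E.
  apply: eq_integral => t; rewrite inE/= in_itv/= => /andP[t0 _].
  by rewrite mellin_weight_expR.
transitivity ((x `^ (- q))%:E * \int[leb]_(t in `]0%R, x]) (fracpart (x / t) * t `^ (q - 1))%:E)%E.
  apply: ge0_integralZl.
  - exact: itv_measurable.
  - apply/measurable_EFinP/cara_measurable_fun; first exact: measurable_itv.
    by apply: measurable_funM; [exact: measurable_fracpart_div|exact: measurable_powRe].
  - by move=> t _; rewrite lee_fin mulr_ge0 ?fracpart_ge0// powR_ge0.
  - by rewrite lee_fin powR_ge0.
have xn : x != 0 by rewrite gt_eqF.
rewrite h -EFinM mulrA -powRD ?xn ?implybT// addrC subrr powRr0 mul1r.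
by [].
Qed.

Lemma mellin_far_real x q : 0 < x -> q < 1 -> mellin_far x q%:C = ((1 - q)^-1)%:C.
Proof.
move=> x0 q1; have q10 : q - 1 < 0 by rewrite subr_lt0.
have h := integral_powR_y x0 q10.
rewrite /mellin_far.
have -> : (fun t => (mellin_weight x t)%:C * cexp (q%:C * (mellin_log x t)%:C)) =
    (fun t => (mellin_weight x t * expR (q * mellin_log x t))%:C).
  by apply/funext => t; exact: real_cexpM.
apply: cint_real.
transitivity (\int[leb]_(t in `]x, +oo[) ((x `^ (1 - q))%:E * (t `^ (q - 1 - 1))%:E))%E.
  apply: eq_integral => t; rewrite inE/= in_itv/= andbT => xt.
  by rewrite mellin_weight_expRy.
transitivity ((x `^ (1 - q))%:E * \int[leb]_(t in `]x, +oo[) (t `^ (q - 1 - 1))%:E)%E.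
  apply: ge0_integralZl.
  - exact: itv_measurable.
  - apply/measurable_EFinP/cara_measurable_fun; first exact: measurable_itv.
    exact: measurable_powRe.
  - by move=> t _; rewrite lee_fin powR_ge0.
  - by rewrite lee_fin powR_ge0.
have xn : x != 0 by rewrite gt_eqF.
rewrite h -EFinM mulrA -powRD ?xn ?implybT// opprB addrA subrK subrr powRr0 mul1r.
by [].
Qed.

Lemma cpow_ln t s : 0 < t -> cpow t s = cexp (s * (ln t)%:C).
Proof.
move=> t0; rewrite /cpow /cexp cReM cImM/= !mulr0 subr0 add0r /powR gt_eqF//.
Qed.

(** On the real axis the Dirichlet series of zeta has real terms, so that the
    value can be compared with the real sum of [integral_fracpart_powR]. *)
Lemma zeta_real_series (zeta : R[i] -> R[i]) (q : R) : is_riemann_zeta zeta -> 1 < q ->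
  exists2 z : R, zeta q%:C = z%:C &
    \sum_(0 <= k < n) k.+1%:R `^ (- q) @[n --> \oo] --> z.
Proof.
move=> [hz _] q1; have /cvgC_normc := hz q%:C q1.
set u := series _ => hu.
have E n : u n = (\sum_(0 <= k < n) k.+1%:R `^ (- q))%:C.
  rewrite /u /series /= rmorph_sum; apply: eq_bigr => k _.
  by rewrite /cpow /= oppr0 mul0r cos0 sin0 -complexr0 mulr1.
have hRe : complex.Re (u n) @[n --> \oo] --> complex.Re (zeta q%:C).
  apply/subr_cvg0/norm_cvg0P; apply: (squeeze_cvg0 _ hu) => n.
  by rewrite normr_ge0 -raddfB ler_Re_normc.
have hIm : complex.Im (zeta q%:C) = 0.
  apply/eqP; rewrite -normr_le0; apply/ler_addgt0Pr => e e0; rewrite add0r.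
  move/cvgrPdist_lt : hu => /(_ _ e0) [N _ /(_ N (leqnn N))].
  rewrite /= sub0r normrN ger0_norm ?normc_ge0// => h.
  rewrite (le_trans _ (ltW h))// (le_trans _ (ler_Im_normc _))//.
  by rewrite raddfB/= E/= sub0r normrN.
exists (complex.Re (zeta q%:C)); first by move: hIm; case: (zeta _) => a b /= ->.
by have -> : (fun n => \sum_(0 <= k < n) k.+1%:R `^ (- q)) = (fun n => complex.Re (u n)) by apply/funext => n; rewrite E.
Qed.

Lemma vanishes_near_real_axis (f : R[i] -> R[i]) (p d : R) : 0 < d ->
  analytic_at f p%:C -> (forall q, p < q -> q < p + d -> f q%:C = 0) ->
  vanishes_near f p%:C.
Proof.
move=> d0 fp fq; apply: (vanishes_near_direction fp (oner_neq0 _) d0) => t t0 td.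
by rewrite mulr1 -rmorphD/= fq// ?ltrDl ?ltrD2l.
Qed.

(** Analytic continuation of
    [mellin_near x s = 1 / (s - 1) - zeta s / s] from real values
    [s > 1].  The relation is multiplied by [s (s - 1)] to avoid quotients of
    analytic functions. *)
Lemma mellin_nearE (zeta : R[i] -> R[i]) x s : is_riemann_zeta zeta -> 0 < x ->
  0 < complex.Re s < 1 ->
  (s - 1) * zeta s + s * ((s - 1) * mellin_near x s - 1) = 0.
Proof.
move=> hzeta x0 /andP[s0 s1].
(* The factor s is written s - 0 to be recognized as an affine factor. *)
pose k (s : R[i]) := (s - 1) * zeta s + (s - 0) * ((s - 1) * mellin_near x s + (-1)).
have kan a : a != 1 -> 0 < complex.Re a -> analytic_at k a.
  move=> a1 a0; apply: analyticD; first by apply: analytic_affineM; exact: hzeta.2.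
  apply: analytic_affineM; apply: analyticD; last exact: analytic_cst.
  by apply: analytic_affineM; exact: analytic_mellin_near.
have k2 : vanishes_near k 2%:C.
  apply: (@vanishes_near_real_axis _ _ 1) => //.
    by apply: kan => //=; rewrite eq_complex/= eqxx andbT; apply/eqP; lra.
  move=> q q2 _; have q1 : 1 < q by lra.
  have [z zE hz] := zeta_real_series hzeta q1.
  rewrite /k zE (mellin_near_real x0 q1 hz) -[1 in X in X = _]/(1%:C) subr0.
  rewrite -rmorphN -!(rmorphB, rmorphD, rmorphM) /=; congr (_ %:C).
  field. by rewrite !gt_eqF//; lra.
(* The segment from 2 to s may meet the pole 1, hence the detour by c. *)
set c : R[i] := complex.Re s +i* 1.
have kc : vanishes_near k c.
  apply: (identity_on_segment _ k2) => t /andP[t0 t1]; apply: kan.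
    rewrite eq_complex cReD cImD cReM cImM cReB cImB/=.
    apply/negP => /andP[/eqP h1 /eqP h2].
    have t00 : t = 0 by lra.
    by move: h1; rewrite t00; lra.
  rewrite cReD cReM cReB cImB/=.
  have h1 : 0 <= t * complex.Re s by rewrite mulr_ge0// ltW.
  have [->|tn1] := eqVneq t 1; first by lra.
  have : t < 1 by rewrite lt_neqAle tn1.
  by lra.
have ks : vanishes_near k s.
  apply: (identity_on_segment _ kc) => t /andP[t0 t1]; apply: kan.
    rewrite eq_complex cReD cReM cReB cImB/=.
    apply/negP => /andP[/eqP h1 _].
    by move: h1; lra.
  rewrite cReD cReM cReB cImB/=.
  by lra.
by have := vanishes_near_at ks; rewrite /k subr0.
Qed.

Lemma mellin_farE x s : 0 < x -> complex.Re s < 1 -> (s - 1) * mellin_far x s + 1 = 0.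
Proof.
move=> x0 s1; set p := complex.Re s.
pose k (s : R[i]) := (s - 1) * mellin_far x s + 1.
have kan a : complex.Re a < 1 -> analytic_at k a.
  move=> a1; apply: analyticD; last exact: analytic_cst.
  by apply: analytic_affineM; exact: analytic_mellin_far.
have kp : vanishes_near k p%:C.
  apply: (@vanishes_near_real_axis _ _ (1 - p)); first by rewrite subr_gt0.
    exact: kan.
  move=> q pq q1; have {}q1 : q < 1 by lra.
  rewrite /k mellin_far_real// -[1 in X in X = _]/(1%:C).
  rewrite -!(rmorphB, rmorphD, rmorphM) /=; congr (_ %:C).
  field. by rewrite !gt_eqF//; lra.
have ks : vanishes_near k s.
  apply: (identity_on_segment _ kp) => t /andP[t0 t1]; apply: kan.
  by rewrite cReD cReM cReB cImB/=; rewrite subrr mulr0 mul0r subr0 addr0.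
exact: (vanishes_near_at ks).
Qed.

Lemma mellin_kernelE x t s : 0 < x -> 0 < t ->
  (fracpart (x / t))%:C * cpow t (s - 1) =
  cexp (s * (ln x)%:C) * ((mellin_weight x t)%:C * cexp (s * (mellin_log x t)%:C)).
Proof.
move=> x0 t0; rewrite cpow_ln// /mellin_weight /mellin_log lnM ?posrE ?invr_gt0// lnV ?posrE//.
have -> : (s - 1) * (ln t)%:C = s * (ln x)%:C + s * (ln t - ln x)%:C + (- ln t)%:C.
  by rewrite rmorphB rmorphN /=; ring.
rewrite !cexpD cexp_real expRN lnK ?posrE// rmorphM/=; ring.
Qed.

Lemma normc_real_cexp (w l : R) s :
  normc (w%:C * cexp (s * l%:C)) = `|w| * expR (complex.Re s * l).
Proof. by rewrite Normc.normcM normc_real normc_cexp cReM/= mulr0 subr0. Qed.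

Lemma cintegrable_mellin_near x s : 0 < x -> 0 < complex.Re s ->
  cintegrable leb `]0, x] (fun t => (mellin_weight x t)%:C * cexp (s * (mellin_log x t)%:C)).
Proof.
move=> x0 s0; apply: (cintegrable_le (itv_measurable _) _ (integrable_mellin_weight0 x0 s0)).
  apply: cmeasurableM; [apply: cmeasurable_real|apply: cmeasurable_cexp].
    exact: measurable_mellin_weight.
  exact: measurable_mellin_log.
move=> t tD; have /andP[t0 _] : 0 < t <= x by move: tD; rewrite /= in_itv.
by rewrite normc_real_cexp ger0_norm ?mellin_weight_ge0.
Qed.

Lemma cintegrable_mellin_far x s : 0 < x -> complex.Re s < 1 ->
  cintegrable leb `]x, +oo[ (fun t => (mellin_weight x t)%:C * cexp (s * (mellin_log x t)%:C)).
Proof.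
move=> x0 s1; apply: (cintegrable_le (itv_measurable _) _ (integrable_mellin_weighty x0 s1)).
  apply: cmeasurableM; [apply: cmeasurable_real|apply: cmeasurable_cexp].
    exact: measurable_mellin_weight.
  exact: measurable_mellin_log.
move=> t tD; have xt : x < t by move: tD; rewrite /= in_itv/= andbT.
by rewrite normc_real_cexp ger0_norm ?mellin_weight_ge0// (lt_trans x0).
Qed.

Lemma in_Rpos t : t \in (Rpos : set R) -> 0 < t.
Proof. by rewrite inE/= in_itv/= andbT. Qed.

Lemma Rpos_split x : 0 < x -> Rpos = `]0, x] `|` `]x, +oo[ :> set R.
Proof.
move=> x0; apply/seteqP; split => t /=; rewrite !in_itv/= ?andbT.
  by case: (leP t x) => tx t0; [left; rewrite t0|right].
by move=> [/andP[]//|]; exact: lt_trans.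
Qed.

Lemma cint_setU (D1 D2 : set R) (f : R -> R[i]) :
  measurable (D1 : set cara) -> measurable (D2 : set cara) -> [disjoint D1 & D2] ->
  cintegrable leb D1 f -> cintegrable leb D2 f ->
  cint leb (D1 `|` D2) f = cint leb D1 f + cint leb D2 f.
Proof.
move=> m1 m2 D12 [f1 f2] [g1 g2]; rewrite /cint; simpc.
by rewrite !Rintegral_setU//; exact: integrable_setU_disjoint.
Qed.

(** When [zeta s = 0], the near part [1 / (s - 1) - zeta s / s] and the far part
    [1 / (1 - s)] cancel. *)
Lemma mellin_fracpart_eq0 (zeta : R[i] -> R[i]) x s : is_riemann_zeta zeta ->
  zeta s = 0 -> 0 < complex.Re s < 1 -> 0 < x ->
  cint leb Rpos (fun t => (fracpart (x / t))%:C * cpow t (s - 1)) = 0.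
Proof.
move=> hzeta z0 s01 x0; have /andP[s0 s1] := s01.
pose f t := (mellin_weight x t)%:C * cexp (s * (mellin_log x t)%:C).
have -> : cint leb Rpos (fun t => (fracpart (x / t))%:C * cpow t (s - 1)) =
    cint leb Rpos (fun t => cexp (s * (ln x)%:C) * f t).
  congr (_ +i* _); apply: eq_Rintegral => t /in_Rpos t0; by rewrite mellin_kernelE.
have fn := cintegrable_mellin_near x0 s0.
have ff := cintegrable_mellin_far x0 s1.
have D12 : [disjoint `]0, x]%classic & `]x, +oo[%classic].
  apply/disj_setPS => t [/=]; rewrite !in_itv/= andbT => /andP[_ tx].
  by rewrite ltNge tx.
have mU : measurable (Rpos : set cara) := itv_measurable _.
have fi : cintegrable leb Rpos f.
  have [? ?] := fn; have [? ?] := ff.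
  by rewrite (Rpos_split x0); split; apply: integrable_setU_disjoint => //; exact: itv_measurable.
rewrite (cintM mU _ fi).2 (Rpos_split x0) (cint_setU _ _ D12 fn ff); [|exact: itv_measurable..].
rewrite -/(mellin_near x s) -/(mellin_far x s).
have hn := mellin_nearE hzeta x0 s01; rewrite z0 mulr0 add0r in hn.
have hf := mellin_farE x0 s1.
have sn0 : s != 0 by apply: contraTneq s0 => ->; rewrite ltxx.
have s10 : s - 1 != 0.
  by rewrite subr_eq0; apply: contraTneq s1 => ->; rewrite ltxx.
move/eqP : hn; rewrite mulf_eq0 (negbTE sn0)/= subr_eq0 => /eqP hn.
have : (s - 1) * (mellin_near x s + mellin_far x s) = 0.
  by rewrite mulrDr hn addrC.
by move/eqP; rewrite mulf_eq0 (negbTE s10)/= => /eqP ->; rewrite mulr0.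
Qed.

End Kernel.

(** * Orthogonality by Fubini's theorem *)

Section FubiniDomain.
Context d1 d2 (T1 : measurableType d1) (T2 : measurableType d2) (R : realType).
Variable m1 : {sigma_finite_measure set T1 -> \bar R}.
Variable m2 : {sigma_finite_measure set T2 -> \bar R}.
Variables (D1 : set T1) (D2 : set T2) (mD1 : measurable D1) (mD2 : measurable D2).
Variables (K : T1 * T2 -> R) (a : T1 -> R) (b : T2 -> R) (H : T1 -> R).
Hypotheses (mK : measurable_fun setT K) (ma : measurable_fun D1 a) (mb : measurable_fun D2 b).
Hypothesis K_le : forall x, D1 x ->
  (\int[m2]_(y in D2) `|K (x, y) * b y|%:E <= (H x)%:E)%E.
Hypothesis iaH : m1.-integrable D1 (fun x => (a x * H x)%:E).

(** Extension of the integrand by 0 to the whole product space. *)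
Let F (z : T1 * T2) : \bar R := (K z * (a \_ D1) z.1 * (b \_ D2) z.2)%:E.

Let mF : measurable_fun setT F.
Proof.
apply/measurable_EFinP; apply: measurable_funM; first apply: measurable_funM => //.
- apply: (measurableT_comp _ measurable_fst).
  exact/(measurable_restrictT _ mD1).1.
- apply: (measurableT_comp _ measurable_snd).
  exact/(measurable_restrictT _ mD2).1.
Qed.

Let FE1 x y : F (x, y) = (((fun y => K (x, y) * (a \_ D1) x * b y) \_ D2) y)%:E.
Proof. by rewrite /F /= /patch; case: (y \in D2); rewrite ?mulr0. Qed.

Let FE2 x y : F (x, y) = (((fun x => K (x, y) * a x * (b \_ D2) y) \_ D1) x)%:E.
Proof. by rewrite /F /= /patch; case: (x \in D1); rewrite ?mulr0 ?mul0r. Qed.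

Let mKb x : measurable_fun D2 (fun y => K (x, y) * b y).
Proof.
apply: measurable_funM => //; apply: measurable_funTS.
exact: (measurableT_comp mK (pair1_measurable x)).
Qed.

Let H0 x : D1 x -> 0 <= H x.
Proof.
by move=> Dx; rewrite -lee_fin (le_trans _ (K_le Dx))// integral_ge0.
Qed.

Let inner_abs x : (\int[m2]_y `|F (x, y)| <= ((fun x => `|a x * H x|%:E) \_ D1) x)%E.
Proof.
rewrite [leRHS]/patch; case: ifPn => [/set_mem Dx|xn]; last first.
  rewrite integral0_eq// => y _.
  by rewrite FE2 /patch (negbTE xn) abse0.
apply: (@le_trans _ _ (\int[m2]_(y in D2) (`|a x|%:E * `|K (x, y) * b y|%:E))%E).
  rewrite [leRHS]integral_mkcond le_eqVlt; apply/orP; left; apply/eqP.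
  apply: eq_integral => y _; rewrite FE1 /patch (mem_set Dx).
  case: ifP => _; last by rewrite abse0.
  by rewrite -EFinM -normrM [K _ * _]mulrC -mulrA.
rewrite ge0_integralZl//; last first.
  by apply/measurable_EFinP; apply: measurableT_comp.
rewrite normrM EFinM lee_wpmul2l//.
by rewrite (ger0_norm (H0 Dx)); exact: K_le.
Qed.

Let iF : (m1 \x m2)%E.-integrable setT F.
Proof.
apply/(integrable12ltyP m1 m2 mF).
apply: (@le_lt_trans _ _ (\int[m1]_(x in D1) `|a x * H x|%:E)%E); last first.
  by have /integrableP[_] := iaH.
rewrite [leRHS]integral_mkcond; apply: ge0_le_integral => //.
- by move=> x _; exact: integral_ge0.
- apply: (measurable_fun_fubini_tonelli_F (abse \o F)).
    exact: measurableT_comp.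
  by move=> z; exact: abse_ge0.
- apply/(measurable_restrictT _ mD1).1/measurable_EFinP; apply: measurableT_comp => //.
  by have /measurable_int/measurable_EFinP := iaH.
Qed.

Hypothesis iKa : forall y, D2 y -> m1.-integrable D1 (fun x => (K (x, y) * a x)%:E).

Let G y : R := (\int[m1]_(x in D1) (K (x, y) * a x)) * b y.

Let GE y : (\int[m1]_x F (x, y) = ((G \_ D2) y)%:E)%E.
Proof.
rewrite [in RHS]/patch; case: ifPn => [/set_mem Dy|yn]; last first.
  by rewrite integral0_eq// => x _; rewrite FE1 /patch (negbTE yn).
have -> : (\int[m1]_x F (x, y) = \int[m1]_(x in D1) ((b y)%:E * (K (x, y) * a x)%:E))%E.
  rewrite [RHS]integral_mkcond; apply: eq_integral => x _; rewrite FE2 /patch.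
  by rewrite (mem_set Dy); case: ifP => // _; rewrite -EFinM mulrC.
rewrite integralZl//; last exact: iKa.
rewrite /G /Rintegral mulrC EFinM fineK//.
by apply: integrable_fin_num => //; exact: iKa.
Qed.

Let GP y : ((G \_ D2) y)%:E = ((fun y => (G y)%:E) \_ D2) y.
Proof. by rewrite /patch; case: ifP. Qed.

Lemma fubini_kernel_integrable : m2.-integrable D2 (fun y => (G y)%:E).
Proof.
apply/(integrable_mkcond _ mD2).2.
have -> : (fun y => (G y)%:E) \_ D2 = (fun y => \int[m1]_x F (x, y))%E.
  by apply/funext => y; rewrite -GP -GE.
have mG := measurable_fubini_G iF.
apply/integrableP; split; first exact: mG.
apply: le_lt_trans ((integrable21ltyP m1 m2 mF).1 iF).
apply: ge0_le_integral => //.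
- exact: measurableT_comp mG.
- apply: (measurable_fun_fubini_tonelli_G (abse \o F)).
    exact: measurableT_comp.
  by move=> z; exact: abse_ge0.
- move=> y _; apply: le_abse_integral => //.
  exact: (measurableT_comp mF (pair2_measurable y)).
Qed.

Hypothesis K_eq0 : forall x, D1 x -> (\int[m2]_(y in D2) (K (x, y) * b y)%:E = 0)%E.

Lemma fubini_kernel_eq0 : (\int[m2]_(y in D2) (G y)%:E = 0)%E.
Proof.
rewrite integral_mkcond.
transitivity (\int[m2]_y \int[m1]_x F (x, y))%E.
  by apply: eq_integral => y _; rewrite -GP -GE.
rewrite -(Fubini iF) integral0_eq// => x _.
have [Dx|Dx] := pselect (D1 x); last first.
  by rewrite integral0_eq// => y _; rewrite FE2 /patch memNset.
transitivity (\int[m2]_(y in D2) ((a x)%:E * (K (x, y) * b y)%:E))%E.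
  rewrite [RHS]integral_mkcond; apply: eq_integral => y _; rewrite FE1 /patch (mem_set Dx).
  by case: ifP => // _; rewrite -EFinM; congr EFin; ring.
rewrite integralZl//; first by rewrite K_eq0// mule0.
apply/integrableP; split; first exact/measurable_EFinP.
by apply: le_lt_trans (ltry (H x)); exact: K_le.
Qed.

End FubiniDomain.

Lemma powR_le1D (R : realType) (x p : R) : 0 <= x -> 0 < p < 1 -> x `^ p <= 1 + x.
Proof.
move=> x0 /andP[p0 p1]; have [x1|x1] := leP x 1.
  apply: (@le_trans _ _ 1); last by rewrite lerDl.
  have <- : 1 `^ p = 1 :> R by rewrite powR1.
  by apply: ge0_ler_powR => //; rewrite ?nnegrE// ltW.
apply: (@le_trans _ _ x); last by rewrite lerDr.
by rewrite -[X in _ <= X](powRr1 x0); apply: ler_powR; exact: ltW.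
Qed.

Section Fubini.
Variable R : realType.
Local Open Scope complex_scope.
Local Notation cara := (caratheodory_type (wlength (R := R) idfun)^*%mu).
Local Notation leb := (@completed_lebesgue_measure R).
Variables (g T : R -> R) (sigma : R).
Hypothesis sigma01 : 0 < sigma < 1.
Hypothesis ig : leb.-integrable Rpos (fun x => (g x)%:E).
Hypothesis ig' : leb.-integrable Rpos (fun x => (g x / x)%:E).
Hypothesis mT : measurable_fun (Rpos : set cara) T.
Hypothesis T_le : forall t, 0 < t -> `|T t| <= t `^ (sigma - 1).

Let mRpos : measurable (Rpos : set cara) := itv_measurable _.

Lemma measurable_cara_id : measurable_fun setT (idfun : cara -> R).
Proof. by move=> _ B mB; rewrite setTI; exact: cara_measurable. Qed.

Let s0 : 0 < sigma. Proof. by case/andP: sigma01. Qed.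
Let s1 : sigma < 1. Proof. by case/andP: sigma01. Qed.

(** Bounding [{x/t}] by 1 for [t <= x] and by [x/t] for [t > x] shows that the
    kernel is integrable against [t^(sigma-1)], with the size [x^sigma] that
    Fubini's theorem requires. *)
Lemma integral_fracpart_le x : 0 < x ->
  (\int[leb]_(t in Rpos) (fracpart (x / t) * t `^ (sigma - 1))%:E <=
   (x `^ sigma * (sigma^-1 + (1 - sigma)^-1))%:E)%E.
Proof.
move=> x0.
have mf (D : set R) : measurable D -> measurable_fun (D : set cara) (fun t : R => (fracpart (x / t) * t `^ (sigma - 1))%:E).
  move=> mD; apply/measurable_EFinP/cara_measurable_fun => //.
  by apply: measurable_funM; [exact: measurable_fracpart_div|exact: measurable_powRe].
have mp (D : set R) p : measurable D -> measurable_fun (D : set cara) (fun t : R => (t `^ p)%:E).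
  by move=> mD; apply/measurable_EFinP/cara_measurable_fun => //; exact: measurable_powRe.
have f0 t : (0 <= (fracpart (x / t) * t `^ (sigma - 1))%:E)%E.
  by rewrite lee_fin mulr_ge0 ?fracpart_ge0 ?powR_ge0.
have D12 : [disjoint `]0, x]%classic & `]x, +oo[%classic].
  apply/disj_setPS => t [/=]; rewrite !in_itv/= andbT => /andP[_ tx].
  by rewrite ltNge tx.
have mfR : measurable_fun (`]0, x] `|` `]x, +oo[ : set cara) (fun t : R => (fracpart (x / t) * t `^ (sigma - 1))%:E).
  by rewrite -(Rpos_split x0); apply: mf; exact: measurable_itv.
rewrite (Rpos_split x0) (ge0_integral_setU _ (itv_measurable _) (itv_measurable _) mfR (fun t _ => f0 t) D12).
rewrite mulrDr EFinD; apply: leeD.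
  rewrite -(integral_powR_0 x0 s0); apply: ge0_le_integral.
  - exact: itv_measurable.
  - by move=> t _; exact: f0.
  - by apply: mf; exact: measurable_itv.
  - by apply: mp; exact: measurable_itv.
  - move=> t; rewrite /= in_itv/= => /andP[t0 _]; rewrite lee_fin ler_piMl ?powR_ge0//.
    by rewrite ltW// fracpart_lt1.
have sm : sigma - 1 < 0 by rewrite subr_lt0.
have xn : x != 0 by rewrite gt_eqF.
have -> : x `^ sigma / (1 - sigma) = x * (x `^ (sigma - 1) / - (sigma - 1)).
  rewrite opprB mulrA; congr (_ / _).
  by rewrite -{2}[x](powRr1 (ltW x0)) -powRD ?xn ?implybT// addrC subrK.
have h := integral_powR_y x0 sm.
rewrite EFinM -h -ge0_integralZl; last 4 first.
- exact: itv_measurable.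
- by apply: mp; exact: measurable_itv.
- by move=> t _; rewrite lee_fin powR_ge0.
- by rewrite lee_fin ltW.
apply: ge0_le_integral.
- exact: itv_measurable.
- by move=> t _; exact: f0.
- by apply: mf; exact: measurable_itv.
- by apply: measurable_funeM; apply: mp; exact: measurable_itv.
- move=> t; rewrite /= in_itv/= andbT => xt; have t0 := lt_trans x0 xt.
  have tn : t != 0 by rewrite gt_eqF.
  rewrite -EFinM lee_fin [t `^ (sigma - 1 - 1)]powRB ?tn ?implybT// (powRr1 (ltW t0)).
  rewrite mulrCA mulrC ler_wpM2l ?powR_ge0//.
  by rewrite fracpart_le// divr_ge0// ltW.
Qed.

Lemma gcross_integrand_integrable t : 0 < t ->
  leb.-integrable Rpos (fun x => (fracpart (x / t) * (g x / x))%:E).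
Proof.
move=> t0; apply: (le_integrable mRpos _ _ ig').
  apply/measurable_EFinP/measurable_funM.
    apply: cara_measurable_fun; first exact: measurable_itv.
    apply: measurable_funTS; apply: (@measurableT_comp _ _ _ _ _ _ (@fracpart R) _ (fun x : R => x / t)).
      exact: measurable_fracpart.
    by apply: measurable_funM => //; exact: measurable_cst.
  by have /measurable_int/measurable_EFinP := ig'.
move=> x _; rewrite lee_fin normrM ger0_norm ?fracpart_ge0//.
by rewrite ler_piMl// ltW// fracpart_lt1.
Qed.

Let C := sigma^-1 + (1 - sigma)^-1.

(** As [x^sigma <= 1 + x], both integrability hypotheses on [g] are used here. *)
Let igC : leb.-integrable Rpos (fun x => (g x / x * (x `^ sigma * C))%:E).
Proof.
have C0 : 0 <= C by rewrite addr_ge0// invr_ge0 ltW// subr_gt0.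
have iabs := integrableZl mRpos C (integrableD mRpos (integrable_abse ig) (integrable_abse ig')).
apply: (le_integrable mRpos _ _ iabs).
  apply/measurable_EFinP/measurable_funM.
    by have /measurable_int/measurable_EFinP := ig'.
  apply: measurable_funM; last exact: measurable_cst.
  by apply: cara_measurable_fun; [exact: measurable_itv|exact: measurable_powRe].
move=> x /mem_set/in_Rpos x0.
rewrite -EFinD -EFinM lee_fin [leRHS]ger0_norm; last by rewrite mulr_ge0// addr_ge0.
rewrite mulrA [leLHS]normrM (ger0_norm C0) [leRHS]mulrC; apply: ler_wpM2r => //.
have xi0 : 0 <= x^-1 by rewrite invr_ge0 ltW.
rewrite normrM (ger0_norm (powR_ge0 _ _)) normrM (ger0_norm xi0).
have -> : `|g x| + `|g x| / x = `|g x| / x * (1 + x).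
  by rewrite mulrDr mulr1 divfK ?gt_eqF// addrC.
apply: ler_wpM2l; first exact: mulr_ge0.
exact: powR_le1D (ltW x0) sigma01.
Qed.

Let K (z : cara * cara) : R := fracpart (z.1 / z.2).

Let mK : measurable_fun setT K.
Proof.
apply: (@measurableT_comp _ _ _ _ _ _ (@fracpart R) _ (fun z : cara * cara => z.1 / z.2 : R)).
  exact: measurable_fracpart.
apply: measurable_funM.
  exact: (measurableT_comp measurable_cara_id measurable_fst).
apply: (@measurableT_comp _ _ _ _ _ _ (@GRing.inv R) _ (fun z : cara * cara => z.2 : R)).
  exact: measurable_inv.
exact: (measurableT_comp measurable_cara_id measurable_snd).
Qed.

Let ma : measurable_fun (Rpos : set cara) (fun x => g x / x).
Proof. by have /measurable_int/measurable_EFinP := ig'. Qed.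

Let GE : (fun t => (gcross g t * T t)%:E) =
    (fun t => (\int[leb]_(x in Rpos) (K (x, t) * (g x / x)) * T t)%:E).
Proof.
apply/funext => t; congr ((_ * _)%:E); rewrite /gcross.
by apply: eq_Rintegral => x _; rewrite mulrA.
Qed.

Let K_le x : Rpos x ->
  (\int[leb]_(t in Rpos) `|K (x, t) * T t|%:E <= (x `^ sigma * C)%:E)%E.
Proof.
move=> /mem_set/in_Rpos x0; apply: le_trans (integral_fracpart_le x0).
apply: ge0_le_integral.
- exact: mRpos.
- by move=> t _; rewrite lee_fin.
- apply/measurable_EFinP; apply: measurableT_comp => //; apply: measurable_funM; last exact: mT.
  apply: cara_measurable_fun; first exact: measurable_itv.
  by apply: measurable_fracpart_div; exact: measurable_itv.
- apply/measurable_EFinP; apply: cara_measurable_fun; first exact: measurable_itv.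
  apply: measurable_funM; last exact: measurable_powRe.
  by apply: measurable_fracpart_div; exact: measurable_itv.
- move=> t /mem_set/in_Rpos t0; rewrite lee_fin normrM ger0_norm ?fracpart_ge0//.
  by apply: ler_wpM2l; [exact: fracpart_ge0|exact: T_le].
Qed.

Let iKa t : Rpos t -> leb.-integrable Rpos (fun x => (K (x, t) * (g x / x))%:E).
Proof. by move=> /mem_set/in_Rpos t0; exact: gcross_integrand_integrable. Qed.

Lemma integrable_gcrossM : leb.-integrable Rpos (fun t => (gcross g t * T t)%:E).
Proof. by rewrite GE; exact: (fubini_kernel_integrable mRpos mRpos mK ma mT K_le igC iKa). Qed.

Hypothesis T_eq0 : forall x, 0 < x ->
  (\int[leb]_(t in Rpos) (fracpart (x / t) * T t)%:E = 0)%E.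

Lemma integral_gcross_eq0 : (\int[leb]_(t in Rpos) (gcross g t * T t)%:E = 0)%E.
Proof.
rewrite GE; apply: (fubini_kernel_eq0 mRpos mRpos mK ma mT K_le igC iKa).
by move=> x /mem_set/in_Rpos x0; exact: T_eq0.
Qed.

End Fubini.

(** * The transform near infinity *)

Section GcrossTail.
Variable R : realType.
Local Notation cara := (caratheodory_type (wlength (R := R) idfun)^*%mu).
Local Notation leb := (@completed_lebesgue_measure R).
Variable G : R -> R.
Hypothesis iG : leb.-integrable Rpos (fun x => (G x)%:E).
Hypothesis iG' : leb.-integrable Rpos (fun x => (G x / x)%:E).

Let mRpos : measurable (Rpos : set cara) := itv_measurable _.

(** Fubini's theorem provides the measurability of [gcross G] times a power;
    dividing by the power recovers that of [gcross G]. *)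
Lemma measurable_gcross : measurable_fun (Rpos : set cara) (gcross G).
Proof.
have h01 : 0 < (2^-1 : R) < 1 by rewrite invr_gt0 ltr0n /= invf_lt1// ltr1n.
have mW p : measurable_fun (Rpos : set cara) (fun t : R => t `^ p).
  by apply: cara_measurable_fun; [exact: measurable_itv|exact: measurable_powRe].
have W_le (t : R) : 0 < t -> `|t `^ (2^-1 - 1)| <= t `^ (2^-1 - 1).
  by move=> _; rewrite ger0_norm ?powR_ge0.
have /measurable_int/measurable_EFinP h := integrable_gcrossM h01 iG iG' (mW _) W_le.
have := measurable_funM h (mW (1 - 2^-1)).
apply: eq_measurable_fun => t /in_Rpos t0.
have tn : t != 0 by rewrite gt_eqF.
rewrite /= -mulrA -powRD ?tn ?implybT//.
by rewrite -opprB addNr powRr0 mulr1.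
Qed.

(** On [x <= M < t] one has [t {x/t} / x = 1], so the two integrands agree; on
    [x > M] the factor [t {x/t} / x] lies between 0 and 1, so they differ by at most
    [|G x|]. *)
Lemma gcross_tail M t : 0 < M -> M < t ->
  `|t * gcross G t - \int[leb]_(x in Rpos) G x| <= \int[leb]_(x in `]M, +oo[) `|G x|.
Proof.
move=> M0 Mt; have t0 := lt_trans M0 Mt.
have i1 := gcross_integrand_integrable iG' t0.
have -> : gcross G t = \int[leb]_(x in Rpos) (fracpart (x / t) * (G x / x)).
  by apply: eq_Rintegral => x _; rewrite mulrA.
have i2 : leb.-integrable Rpos (EFin \o (fun x => t * (fracpart (x / t) * (G x / x)))).
  exact: (integrableZl mRpos t i1).
rewrite -(RintegralZl t mRpos i1) -(RintegralB mRpos i2 iG).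
apply: (le_trans (le_normr_Rintegral mRpos (integrableB mRpos i2 iG))).
have sub : `]M, +oo[%classic `<=` (Rpos : set R).
  by move=> x /=; rewrite !in_itv/= !andbT; exact: lt_trans.
have -> : \int[leb]_(x in `]M, +oo[) `|G x| =
    \int[leb]_(x in Rpos) ((fun x => `|G x|) \_ `]M, +oo[) x.
  by rewrite -Rintegral_mkcondr; congr (Rintegral _ _ _); apply/esym/setIidr.
apply: le_Rintegral => //.
- exact: (integrable_abse (integrableB mRpos i2 iG)).
- have := (integrable_abse iG).
  apply: (le_integrable mRpos).
    apply/measurable_EFinP/measurable_restrict => //; first exact: itv_measurable.
    apply: (measurable_funS mRpos); first by move=> x [].
    by apply: measurableT_comp => //; have /measurable_int/measurable_EFinP := iG.
  move=> x _; rewrite /= /patch; case: ifP => _; rewrite lee_fin ?normr_id//.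
  by rewrite normr0.
move=> x /mem_set/in_Rpos x0; rewrite /patch; case: ifPn => [xM|]; last first.
  rewrite notin_setE/= in_itv/= andbT => /negP; rewrite -leNgt => xM.
  rewrite fracpart_id; last first.
    by rewrite divr_ge0 ?ltW//= ltr_pdivrMr// mul1r (le_lt_trans xM).
  rewrite (_ : t * _ - _ = 0) ?normr0//; field.
  by rewrite !gt_eqF.
have -> : t * (fracpart (x / t) * (G x / x)) - G x = G x * (t / x * fracpart (x / t) - 1).
  by field; rewrite gt_eqF.
rewrite normrM ler_piMr//.
have h0 : 0 <= t / x * fracpart (x / t).
  by rewrite mulr_ge0 ?fracpart_ge0// divr_ge0// ltW.
have h1 : t / x * fracpart (x / t) <= 1.
  rewrite -[leRHS](_ : t / x * (x / t) = 1); last by field; rewrite !gt_eqF.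
  apply: ler_wpM2l; first by rewrite divr_ge0// ltW.
  by apply: fracpart_le; rewrite divr_ge0// ltW.
by rewrite ler_norml; lra.
Qed.

End GcrossTail.

(** * The approximation error *)

Lemma ge0_Rintegral_subset d (T : measurableType d) (R : realType)
    (mu : {measure set T -> \bar R}) (A B : set T) (f : T -> R) :
  measurable A -> measurable B -> A `<=` B ->
  mu.-integrable B (EFin \o f) -> (forall x, B x -> 0 <= f x) ->
  \int[mu]_(x in A) f x <= \int[mu]_(x in B) f x.
Proof.
move=> mA mB AB iB f0; have iA := integrableS mB mA AB iB.
apply: fine_le.
- exact: integrable_fin_num.
- exact: integrable_fin_num.
- apply: ge0_subset_integral => //.
  by case/integrableP : iB.
Qed.

(** Replaces the Cauchy-Schwarz inequality below: the weight [a] may be any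
    function of the integration variable, or a constant to be optimized. *)
Lemma weighted_amgm (R : realFieldType) (a x w : R) : 0 < a ->
  2 * (x * w) <= a * x ^+ 2 + w ^+ 2 / a.
Proof.
move=> a0; rewrite -subr_ge0.
rewrite (_ : _ - _ = (a * x - w) ^+ 2 / a); last by field; rewrite gt_eqF.
by rewrite divr_ge0 ?sqr_ge0// ltW.
Qed.

Lemma subr_powR2_gt0 (R : realType) (a : R) : a < 1 -> 0 < 1 - 2 `^ (a - 1).
Proof.
move=> a1; rewrite subr_gt0 /powR pnatr_eq0/= -[ltRHS]expR0 ltr_expR.
by rewrite nmulr_rlt0 ?subr_lt0// ln_gt0// ltr1n.
Qed.

Section TailEstimate.
Variable R : realType.
Local Notation cara := (caratheodory_type (wlength (R := R) idfun)^*%mu).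
Local Notation leb := (@completed_lebesgue_measure R).
Variables (sigma : R) (phi G : R -> R) (M : R).
Hypothesis sigma01 : 1 / 2 < sigma < 1.
Hypothesis iphi : leb.-integrable Rpos (fun t => (phi t * t `^ (sigma - 1))%:E).
Hypothesis iG : leb.-integrable Rpos (fun x => (G x)%:E).
Hypothesis iG' : leb.-integrable Rpos (fun x => (G x / x)%:E).
Hypothesis M0 : 0 < M.

Let mRpos : measurable (Rpos : set cara) := itv_measurable _.
Let mitv (i : interval R) : measurable ([set` i] : set cara) := itv_measurable i.

Let f t := phi t - gcross G t.
Let W t := t `^ (sigma - 1).
Let P := \int[leb]_(t in `]0, 2 * M]) `|f t * W t|.
Let Q := \int[leb]_(t in `]M, +oo[) `|phi t * W t|.
Let E := \int[leb]_(x in `]M, +oo[) `|G x|.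
Let A := \int[leb]_(x in Rpos) G x.
Let kappa := 1 - 2 `^ (sigma - 1).

Let s0 : 0 < sigma < 1.
Proof. by case/andP: sigma01 => h ->; rewrite andbT; lra. Qed.
Let s1 : 0 < 1 - sigma.
Proof. by case/andP: sigma01 => _; rewrite subr_gt0. Qed.
Let sm : sigma - 1 < 0.
Proof. by rewrite subr_lt0; case/andP: sigma01. Qed.

Let W0 t : 0 <= W t. Proof. exact: powR_ge0. Qed.

Lemma integrable_approx_error : leb.-integrable Rpos (EFin \o (fun t => f t * W t)).
Proof.
have W_le (t : R) : 0 < t -> `|W t| <= W t by rewrite ger0_norm.
have mW : measurable_fun (Rpos : set cara) W.
  by apply: cara_measurable_fun; [exact: measurable_itv|exact: measurable_powRe].
have := integrableB mRpos iphi (integrable_gcrossM s0 iG iG' mW W_le).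
by apply: eq_integrable => // t _; rewrite -EFinB -mulrBl.
Qed.

Let if_ := integrable_approx_error.

Let iabs (D : set R) (h : R -> R) : measurable (D : set cara) -> D `<=` Rpos ->
  leb.-integrable Rpos (EFin \o h) -> leb.-integrable D (EFin \o (fun t => `|h t|)).
Proof.
move=> mD DR ih; apply: (integrableS mRpos mD DR).
exact: (integrable_abse ih).
Qed.

Let sub_oc (a b : R) : 0 <= a -> `]a, b]%classic `<=` (Rpos : set R).
Proof. by move=> a0 t /=; rewrite !in_itv/= andbT => /andP[+ _]; exact: le_lt_trans. Qed.

Let sub_oy (a : R) : 0 <= a -> `]a, +oo[%classic `<=` (Rpos : set R).
Proof. by move=> a0 t /=; rewrite !in_itv/= !andbT; exact: le_lt_trans. Qed.

Let E0 : 0 <= E.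
Proof. exact: Rintegral_ge0. Qed.

Let tailh t : M < t -> t * `|gcross G t| <= `|A| + E /\ `|A| <= t * `|gcross G t| + E.
Proof.
move=> Mt; have := gcross_tail iG iG' M0 Mt; rewrite -/A -/E => h.
have t0 := lt_trans M0 Mt.
have -> : t * `|gcross G t| = `|t * gcross G t| by rewrite normrM gtr0_norm.
set u := t * _ in h *; split.
  apply: le_trans (lerD (lexx _) h).
  by apply: le_trans (ler_normD _ _); rewrite addrC subrK.
apply: le_trans (lerD (lexx _) h); rewrite distrC.
by apply: le_trans (ler_normD _ _); rewrite addrC subrK.
Qed.

Let Wdiv t : 0 < t -> t * t `^ (sigma - 1 - 1) = W t.
Proof.
move=> t0; have tn : t != 0 by rewrite gt_eqF.
rewrite powRB ?tn ?implybT// (powRr1 (ltW t0)) mulrCA mulfV ?mulr1//.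
Qed.

Let powM : (\int[leb]_(t in `]M, (2 * M)%R]) (t `^ (sigma - 1 - 1))%:E =
  (M `^ (sigma - 1) * (kappa / (1 - sigma)))%:E)%E.
Proof.
rewrite integral_powR_oc ?lt_eqF//; last by rewrite -[ltLHS]mul1r ltr_pM2r// ltr1n.
rewrite powRM ?ltW// /kappa; congr EFin.
by field; rewrite gt_eqF//= lt_eqF.
Qed.

Let ipow (D : set R) : measurable (D : set cara) -> D `<=` `]M, +oo[%classic ->
  leb.-integrable D (EFin \o (fun t => t `^ (sigma - 1 - 1))).
Proof.
by move=> mD DM; apply: (integrableS (mitv _) mD DM); exact: integrable_powR_y.
Qed.

(** On [M < t <= 2M] the quantity [|A|] is at most [t |phi - f| + E].  Against
    [t^(sigma-2)] this gives [P + Q + E m], where [m = M^(sigma-1) kappa / (1 - sigma)]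
    is the mass of [t^(sigma-2)] on that interval. *)
Let A_le : `|A| * (M `^ (sigma - 1) * (kappa / (1 - sigma))) <=
  P + Q + E * (M `^ (sigma - 1) * (kappa / (1 - sigma))).
Proof.
set D : set R := `]M, 2 * M]%classic.
have mD : measurable (D : set cara) by exact: mitv.
have DR : D `<=` (Rpos : set R) by apply: sub_oc; exact: ltW.
have DM : D `<=` `]M, +oo[%classic.
  by move=> t; rewrite /D /= !in_itv/= andbT => /andP[].
have ip := ipow mD DM.
have pM : \int[leb]_(t in D) t `^ (sigma - 1 - 1) = M `^ (sigma - 1) * (kappa / (1 - sigma)).
  by rewrite /Rintegral powM.
have i1 := iabs mD DR if_.
have i2 := iabs mD DR iphi.
have i3 c : leb.-integrable D (EFin \o (fun t => c * t `^ (sigma - 1 - 1))).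
  exact: (integrableZl mD c ip).
have i12 := integrableD mD i1 i2.
have h1 : \int[leb]_(t in D) `|f t * W t| <= P.
  apply: ge0_Rintegral_subset => //.
  - by move=> t; rewrite /D /= !in_itv/= => /andP[Mt ->]; rewrite (lt_trans M0 Mt).
  - by apply: iabs => //; exact: sub_oc.
have h2 : \int[leb]_(t in D) `|phi t * W t| <= Q.
  apply: ge0_Rintegral_subset => //.
  by apply: iabs => //; apply: sub_oy; exact: ltW.
rewrite -pM -!(RintegralZl _ mD ip).
apply: le_trans (lerD (lerD h1 h2) (lexx _)).
rewrite -(RintegralD mD i1 i2) -(RintegralD mD i12 (i3 E)).
apply: le_Rintegral => //; first exact: (integrableD mD i12 (i3 E)).
move=> t; rewrite /D /= in_itv/= => /andP[Mt _].
have t0 := lt_trans M0 Mt; have [_ h] := tailh Mt.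
rewrite !normrM !(ger0_norm (W0 t)) -(Wdiv t0) -mulrDl.
have q0 : 0 <= t `^ (sigma - 1 - 1) by exact: powR_ge0.
rewrite mulrA -mulrDl; apply: ler_wpM2r => //.
apply: (le_trans h); rewrite lerD2r mulrC; apply: ler_wpM2r; first exact: ltW.
have -> : gcross G t = phi t - f t by rewrite /f; ring.
by rewrite [leRHS]addrC ler_normB.
Qed.

(** For [t > M] one has [|f| <= |phi| + (|A| + E) / t]. *)
Let tail_le : \int[leb]_(t in `]M, +oo[) `|f t * W t| <=
  Q + (`|A| + E) * (M `^ (sigma - 1) / (1 - sigma)).
Proof.
set D : set R := `]M, +oo[%classic.
have mD : measurable (D : set cara) by exact: mitv.
have DR : D `<=` (Rpos : set R) by apply: sub_oy; exact: ltW.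
have ip := ipow mD (@subset_refl _ D).
have pM : \int[leb]_(t in D) t `^ (sigma - 1 - 1) = M `^ (sigma - 1) / (1 - sigma).
  by rewrite /Rintegral integral_powR_y//= opprB.
have i1 := iabs mD DR if_.
have i2 := iabs mD DR iphi.
have i3 : leb.-integrable D (EFin \o (fun t => (`|A| + E) * t `^ (sigma - 1 - 1))).
  exact: (integrableZl mD _ ip).
rewrite -pM -(RintegralZl _ mD ip) -(RintegralD mD i2 i3).
apply: le_Rintegral => //; first exact: (integrableD mD i2 i3).
move=> t; rewrite /D /= in_itv/= andbT => Mt.
have t0 := lt_trans M0 Mt; have [h _] := tailh Mt.
rewrite !normrM !(ger0_norm (W0 t)) -(Wdiv t0).
have q0 : 0 <= t `^ (sigma - 1 - 1) by exact: powR_ge0.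
rewrite !mulrA -mulrDl; apply: ler_wpM2r => //.
apply: (le_trans _ (lerD (lexx _) h)); rewrite [t * _]mulrC -mulrDl.
apply: ler_wpM2r; first exact: ltW.
by rewrite /f ler_normB.
Qed.

Let kappa0 : 0 < kappa.
Proof. by apply: subr_powR2_gt0; case/andP: sigma01. Qed.

(** The cut is at [M]: the part [t <= M] is bounded by [P], and the part [t > M]
    by [tail_le], in which [A_le] eliminates [A]. *)
Lemma approx_error_le : \int[leb]_(t in Rpos) `|f t * W t| <=
  (P + Q) * (1 + kappa^-1) + E * M `^ (sigma - 1) * (2 / (1 - sigma)).
Proof.
have i1 := iabs mRpos (@subset_refl _ _) if_.
have PM : \int[leb]_(t in `]0, M]) `|f t * W t| <= P.
  apply: ge0_Rintegral_subset => //.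
  - move=> t; rewrite /= !in_itv/= => /andP[-> tM]/=.
    by rewrite (le_trans tM)// -[leLHS]mul1r ler_pM2r// ler1n.
  - by apply: iabs => //; exact: sub_oc.
rewrite (Rpos_split M0) Rintegral_setU//; first last.
- apply/disj_setPS => t [/=]; rewrite !in_itv/= andbT => /andP[_ tx].
  by rewrite ltNge tx.
- by rewrite -(Rpos_split M0).
apply: (le_trans (lerD PM tail_le)).
have hA := A_le; set m := M `^ (sigma - 1) in hA *.
have h : `|A| * m <= (P + Q) * ((1 - sigma) / kappa) + E * m.
  have k0 : 0 < kappa / (1 - sigma) by rewrite divr_gt0.
  rewrite -(ler_pM2r k0) -[X in X <= _]mulrA (le_trans hA)//.
  rewrite le_eqVlt; apply/orP; left; apply/eqP; field.
  by rewrite !gt_eqF.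
have -> : P + (Q + (`|A| + E) * (m / (1 - sigma))) =
  P + Q + (`|A| * m) / (1 - sigma) + E * m / (1 - sigma) by ring.
have h2 : `|A| * m / (1 - sigma) <= (P + Q) / kappa + E * m / (1 - sigma).
  rewrite ler_pdivrMr// mulrDl divfK ?gt_eqF// (le_trans h)// lerD2r.
  by rewrite mulrA mulrAC.
rewrite (_ : _ * _ + _ = P + Q + ((P + Q) / kappa + E * m / (1 - sigma)) + E * m / (1 - sigma)); last by ring.
by rewrite lerD2r lerD2l.
Qed.

(** Cauchy-Schwarz on [0 < t <= 2M] with a free parameter [L], which
    is chosen later to balance the two terms. *)
Lemma approx_error_near_le (L : R) : 0 < L ->
  leb.-integrable Rpos (EFin \o (fun t => f t ^+ 2)) ->
  P <= (L * (\int[leb]_(t in Rpos) (f t ^+ 2)) +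
        (2 * M) `^ (2 * sigma - 1) / (2 * sigma - 1) / L) / 2.
Proof.
move=> L0 i2.
set D : set R := `]0, 2 * M]%classic.
have mD : measurable (D : set cara) by exact: mitv.
have DR : D `<=` (Rpos : set R) by exact: sub_oc.
have M20 : 0 < 2 * M by rewrite mulr_gt0.
have p0 : 0 < 2 * sigma - 1 by case/andP: sigma01 => h _; lra.
have ip := integrable_powR_0 M20 p0.
have pM : \int[leb]_(t in D) t `^ (2 * sigma - 1 - 1) = (2 * M) `^ (2 * sigma - 1) / (2 * sigma - 1).
  by rewrite /Rintegral integral_powR_0.
have i1 := iabs mD DR if_.
have i2D := integrableS mRpos mD DR i2.
have ha : \int[leb]_(t in D) (f t ^+ 2) <= \int[leb]_(t in Rpos) (f t ^+ 2).
  by apply: ge0_Rintegral_subset => // t _; exact: sqr_ge0.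
apply: (@le_trans _ _ ((L * (\int[leb]_(t in D) (f t ^+ 2)) +
        (2 * M) `^ (2 * sigma - 1) / (2 * sigma - 1) / L) / 2)); last first.
  by rewrite ler_pM2r ?invr_gt0// lerD2r ler_pM2l.
have j1 : leb.-integrable D (EFin \o (fun t => L * f t ^+ 2)) by exact: (integrableZl mD _ i2D).
have j2 : leb.-integrable D (EFin \o (fun t => t `^ (2 * sigma - 1 - 1) * L^-1)).
  have := integrableZl mD L^-1 ip; apply: eq_integrable => // t _.
  by rewrite -EFinM mulrC.
have j12 := integrableD mD j1 j2.
have j3 : leb.-integrable D (EFin \o (fun t => (L * f t ^+ 2 + t `^ (2 * sigma - 1 - 1) * L^-1) * 2^-1)).
  have := integrableZl mD 2^-1 j12; apply: eq_integrable => // t _.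
  by rewrite -EFinM mulrC.
rewrite -pM -(RintegralZl _ mD i2D) -(RintegralZr _ mD ip) -(RintegralD mD j1 j2) -(RintegralZr _ mD j12).
apply: le_Rintegral => //.
move=> t; rewrite /D /= in_itv/= => /andP[t0 _].
have tn : t != 0 by rewrite gt_eqF.
have -> : t `^ (2 * sigma - 1 - 1) = W t ^+ 2.
  by rewrite /W expr2 -powRD ?tn ?implybT//; congr (_ `^ _); ring.
rewrite normrM (ger0_norm (W0 t)) -[f t ^+ 2]real_normK ?num_real//.
rewrite ler_pdivlMr// mulrC; exact: weighted_amgm.
Qed.

End TailEstimate.

(** * Passage to the limit *)

Section Limit.
Variable R : realType.
Local Notation cara := (caratheodory_type (wlength (R := R) idfun)^*%mu).
Local Notation leb := (@completed_lebesgue_measure R).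
Variables (sigma sigma0 : R) (phi : R -> R).
Hypothesis sigma_bounds : 1 / 2 < sigma /\ sigma <= sigma0 /\ sigma0 < 1.
Hypothesis mphi : measurable_fun (Rpos : set cara) phi.
Hypothesis hphi : (\int[leb]_(t in Rpos) ((1 + t) * `|phi t| ^+ 2)%:E < +oo)%E.

Let mRpos : measurable (Rpos : set cara) := itv_measurable _.

Let sigma01 : 1 / 2 < sigma < 1.
Proof. by have [h1 [h2 h3]] := sigma_bounds; rewrite h1 (le_lt_trans h2). Qed.

Let W t := t `^ (sigma - 1).

Let mW p : measurable_fun (Rpos : set cara) (fun t : R => t `^ p).
Proof. by apply: cara_measurable_fun; [exact: measurable_itv|exact: measurable_powRe]. Qed.

(** The exponents are [2 sigma - 2 > - 1] near 0 and [2 sigma - 3 < - 1] at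
    infinity. *)
Let iW : leb.-integrable Rpos (EFin \o (fun t => W t ^+ 2 / (1 + t))).
Proof.
have mh (D : set R) : measurable D -> measurable_fun (D : set cara) (fun t : R => W t ^+ 2 / (1 + t)).
  move=> mD; apply: cara_measurable_fun => //; apply: measurable_funM.
    by apply: measurable_funX; exact: measurable_powRe.
  apply: measurable_funTS; apply: (@measurableT_comp _ _ _ _ _ _ (@GRing.inv R) _ (fun t : R => 1 + t)).
    exact: measurable_inv.
  by apply: measurable_funD => //; exact: measurable_cst.
have WE (t : R) : 0 < t -> W t ^+ 2 = t `^ (2 * sigma - 1 - 1).
  move=> t0; have tn : t != 0 by rewrite gt_eqF.
  by rewrite /W expr2 -powRD ?tn ?implybT//; congr (_ `^ _); ring.
have p0 : 0 < 2 * sigma - 1 by case/andP: sigma01 => h _; lra.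
have p1 : 2 * sigma - 2 < 0 by case/andP: sigma01 => _ h; lra.
rewrite (Rpos_split (@ltr01 R)); apply: integrable_setU_disjoint.
- exact: itv_measurable.
- exact: itv_measurable.
- apply/disj_setPS => t [/=]; rewrite !in_itv/= andbT => /andP[_ tx].
  by rewrite ltNge tx.
- apply: (le_integrable (itv_measurable _) _ _ (integrable_powR_0 (@ltr01 R) p0)).
    by apply/measurable_EFinP/mh; exact: measurable_itv.
  move=> t; rewrite /= in_itv/= => /andP[t0 _]; rewrite lee_fin.
  have t10 : 0 < 1 + t by rewrite addr_gt0.
  rewrite -(WE t t0) !ger0_norm ?sqr_ge0//; last by rewrite divr_ge0 ?sqr_ge0// ltW.
  by rewrite ler_piMr ?sqr_ge0// invf_le1// lerDl ltW.
- apply: (le_integrable (itv_measurable _) _ _ (integrable_powR_y (@ltr01 R) p1)).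
    by apply/measurable_EFinP/mh; exact: measurable_itv.
  move=> t; rewrite /= in_itv/= andbT => t1; rewrite lee_fin.
  have t0 : 0 < t := lt_trans ltr01 t1.
  have tn : t != 0 by rewrite gt_eqF.
  have t10 : 0 < 1 + t by rewrite addr_gt0.
  rewrite (WE t t0) !ger0_norm ?powR_ge0//; last by rewrite divr_ge0 ?powR_ge0// ltW.
  have -> : t `^ (2 * sigma - 2 - 1) = t `^ (2 * sigma - 1 - 1) / t.
    rewrite -{3}[t](powRr1 (ltW t0)) -powRB ?tn ?implybT//; congr (_ `^ _); ring.
  by apply: ler_wpM2l; [exact: powR_ge0|rewrite lef_pV2 ?posrE// lerDr].
Qed.

(** Cauchy-Schwarz with the weight [1 + t], which also shows the absolute
    convergence of the Mellin transform of [phi]. *)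
Let iphi : leb.-integrable Rpos (fun t => (phi t * W t)%:E).
Proof.
have i1 : leb.-integrable Rpos (EFin \o (fun t => (1 + t) * `|phi t| ^+ 2)).
  apply/integrableP; split.
    apply/measurable_EFinP/measurable_funM.
      apply: cara_measurable_fun; first exact: measurable_itv.
      by apply: measurable_funD => //; exact: measurable_cst.
    by apply: measurable_funX; apply: measurableT_comp.
  apply: le_lt_trans hphi; rewrite le_eqVlt; apply/orP; left; apply/eqP.
  apply: eq_integral => t /in_Rpos t0; rewrite /= ger0_norm//.
  by rewrite mulr_ge0 ?sqr_ge0// addr_ge0// ltW.
have i2 := integrableD mRpos i1 iW.
apply: (le_integrable mRpos _ _ i2).
  by apply/measurable_EFinP/measurable_funM => //; exact: mW.
move=> t /mem_set/in_Rpos t0.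
have t10 : 0 < 1 + t by rewrite addr_gt0.
rewrite -EFinD lee_fin normrM (ger0_norm (powR_ge0 _ _)).
apply: le_trans (ler_norm _); apply: le_trans (weighted_amgm `|phi t| (W t) t10).
by rewrite mulr_natl mulr2n lerDl mulr_ge0// powR_ge0.
Qed.

Section Sequence.
Variables (G : nat -> R -> R) (M : nat -> R) (T : R -> R).
Hypothesis iG : forall n, leb.-integrable Rpos (fun x => (G n x)%:E).
Hypothesis iG' : forall n, leb.-integrable Rpos (fun x => (G n x / x)%:E).
Hypothesis mT : measurable_fun (Rpos : set cara) T.
Hypothesis T_le : forall t, 0 < t -> `|T t| <= t `^ (sigma - 1).
Hypothesis T_eq0 : forall x, 0 < x ->
  (\int[leb]_(t in Rpos) (fracpart (x / t) * T t)%:E = 0)%E.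
Hypothesis Moo : M n @[n --> \oo] --> +oo.
Hypothesis L2_cvg : ((M n `^ (2 * sigma0 - 1))%:E *
  \int[leb]_(t in Rpos) ((phi t - gcross (G n) t) ^+ 2)%:E)%E @[n --> \oo] --> 0%E.
Hypothesis tail_cvg : ((M n `^ (sigma0 - 1))%:E *
  \int[leb]_(t in `]M n, +oo[) `|G n t|%:E)%E @[n --> \oo] --> 0%E.

Let Q n := \int[leb]_(t in `]M n, +oo[) `|phi t * W t|.

Let Q_cvg : Q n @[n --> \oo] --> 0.
Proof.
pose h t := `|phi t * W t|.
have mh : measurable_fun (Rpos : set cara) h.
  by apply: measurableT_comp => //; apply: measurable_funM => //; exact: mW.
pose u n := h \_ `]M n, +oo[.
have [] := @dominated_convergence _ _ _ leb Rpos mRpos (fun n => EFin \o u n) (cst 0%E)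
  (EFin \o h).
- move=> n; apply/measurable_EFinP/measurable_restrict => //; first exact: itv_measurable.
  by apply: (measurable_funS mRpos) => // t [].
- exact: measurable_cst.
- apply: aeW => t _; apply: cvg_near_cst.
  near=> n; rewrite /= /u patchE memNset//= in_itv/= andbT; apply/negP.
  by rewrite -leNgt; near: n; move/cvgryPge : Moo; exact.
- exact: (integrable_abse iphi).
- apply: aeW => t n _; rewrite lee_fin /u patchE; case: ifP => _.
    by rewrite /h normr_id.
  by rewrite normr0 /h normr_ge0.
move=> _ _; rewrite integral0 => /fine_cvg; apply: cvg_trans; apply: near_eq_cvg.
near=> n; have Mn0 : 0 < M n by near: n; move/cvgryPgt : Moo; exact.
have -> : (fine \o (fun n => \int[leb]_(x in Rpos) (EFin \o u n) x)%E) n =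
  \int[leb]_(x in Rpos) (h \_ `]M n, +oo[) x by [].
rewrite -Rintegral_mkcondr /Q; congr (Rintegral _ _ _).
apply/setIidr => t /=; rewrite !in_itv/= !andbT; exact: lt_trans.
Unshelve. all: by end_near. Qed.

Let kappa : R := 1 - 2 `^ (sigma - 1).
Let C : R := 2 `^ (2 * sigma - 1) / (2 * sigma - 1).
Let K := ((1 + C) / 2 + 1) * (1 + kappa^-1) + 2 / (1 - sigma).

(** With [L = M^(2 sigma - 1) / eta], the two terms of [approx_error_near_le] are
    of order [eta]: the first by the smallness of
    [M^(2 sigma0 - 1)] times the square integral of the error, the second because
    [L] cancels the power of [M].  The exponents [sigma0] may be lowered to
    [sigma] as [M >= 1]. *)
Let approx_bound_at n eta : 0 < eta -> 1 < M n -> Q n <= eta ->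
  ((M n `^ (2 * sigma0 - 1))%:E *
    \int[leb]_(t in Rpos) ((phi t - gcross (G n) t) ^+ 2)%:E)%E \is a fin_num ->
  `|fine ((M n `^ (2 * sigma0 - 1))%:E *
    \int[leb]_(t in Rpos) ((phi t - gcross (G n) t) ^+ 2)%:E)%E| < eta ^+ 2 ->
  `|fine ((M n `^ (sigma0 - 1))%:E *
    \int[leb]_(t in `]M n, +oo[) `|G n t|%:E)%E| < eta ->
  `|\int[leb]_(t in Rpos) (phi t * T t)| <= K * eta.
Proof.
move=> eta0 M1 Qn fin L2n tailn.
have [sg [sg0 sg1]] := sigma_bounds.
have s01 : 0 < sigma < 1 by case/andP: sigma01 => h ->; rewrite andbT; lra.
have e1 : 2 * sigma - 1 <= 2 * sigma0 - 1 by lra.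
have e2 : sigma - 1 <= sigma0 - 1 by lra.
have s1 : 0 < 1 - sigma by lra.
have s2 : 0 < 2 * sigma - 1 by lra.
have half_le (p a c e : R) : a <= e -> p <= (a + c * e) / 2 -> p <= (1 + c) / 2 * e by lra.
have M0 : 0 < M n by exact: lt_trans M1.
have Mp p : 0 < M n `^ p by exact: powR_gt0.
pose f t := phi t - gcross (G n) t.
have mf : measurable_fun (Rpos : set cara) f.
  by apply: measurable_funB => //; exact: measurable_gcross.
have I_ge0 : (0 <= \int[leb]_(t in Rpos) (f t ^+ 2)%:E)%E.
  by apply: integral_ge0 => t _; rewrite lee_fin sqr_ge0.
have if2 : leb.-integrable Rpos (EFin \o (fun t => f t ^+ 2)).
  apply/integrableP; split.
    by apply/measurable_EFinP; exact: measurable_funX.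
  rewrite (_ : integral _ _ _ = \int[leb]_(t in Rpos) (f t ^+ 2)%:E)%E; last first.
    by apply: eq_integral => t _; rewrite /= ger0_norm ?sqr_ge0.
  (* An infinite square integral would make the product in [fin] infinite. *)
  rewrite ltey; apply/eqP => Ioo; move: fin.
  by rewrite -/(f _) Ioo gt0_muley ?lte_fin.
have sub : `]M n, +oo[%classic `<=` (Rpos : set R).
  by move=> x /=; rewrite !in_itv/= !andbT; exact: lt_trans.
have I2n : M n `^ (2 * sigma0 - 1) * \int[leb]_(t in Rpos) (f t ^+ 2) <= eta ^+ 2.
  apply: le_trans (ltW L2n); apply: le_trans (ler_norm _).
  by rewrite fineM//; exact: (integrable_fin_num mRpos if2).
have En : M n `^ (sigma0 - 1) * \int[leb]_(t in `]M n, +oo[) `|G n t| <= eta.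
  apply: le_trans (ltW tailn); apply: le_trans (ler_norm _).
  rewrite fineM//; apply: (integrable_fin_num (itv_measurable _)).
  apply: (integrableS mRpos (itv_measurable _) sub).
  exact: (integrable_abse (iG n)).
have ifW := integrable_approx_error sigma01 iphi (iG n) (iG' n).
have igT := integrable_gcrossM s01 (iG n) (iG' n) mT T_le.
have mfT : measurable_fun (Rpos : set cara) (fun t => f t * T t) by exact: measurable_funM.
have ifT : leb.-integrable Rpos (EFin \o (fun t => f t * T t)).
  apply: (le_integrable mRpos _ _ ifW); first exact/measurable_EFinP.
  move=> t /mem_set/in_Rpos t0; rewrite /= lee_fin !normrM.
  apply: ler_wpM2l; first exact: normr_ge0.
  by rewrite (ger0_norm (powR_ge0 _ _)); exact: T_le.
have phiTE : \int[leb]_(t in Rpos) (phi t * T t) = \int[leb]_(t in Rpos) (f t * T t).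
  have gT0 : \int[leb]_(t in Rpos) (gcross (G n) t * T t) = 0.
    by rewrite /Rintegral (integral_gcross_eq0 s01 (iG n) (iG' n) mT T_le T_eq0).
  have := RintegralD mRpos ifT igT; rewrite gT0 addr0 => <-.
  by apply: eq_Rintegral => t _; rewrite /f; ring.
rewrite phiTE.
have h0 : `|\int[leb]_(t in Rpos) (f t * T t)| <= \int[leb]_(t in Rpos) `|f t * W t|.
  apply: (le_trans (le_normr_Rintegral mRpos ifT)).
  apply: le_Rintegral.
  - exact: mRpos.
  - exact: (integrable_abse ifT).
  - exact: (integrable_abse ifW).
  move=> t /mem_set/in_Rpos t0; rewrite !normrM.
  apply: ler_wpM2l; first exact: normr_ge0.
  by rewrite (ger0_norm (powR_ge0 _ _)); exact: T_le.
apply: (le_trans h0).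
apply: (le_trans (approx_error_le sigma01 iphi (iG n) (iG' n) M0)).
pose L := M n `^ (2 * sigma - 1) / eta.
have L0 : 0 < L by rewrite divr_gt0.
have := approx_error_near_le sigma01 iphi (iG n) (iG' n) M0 L0 if2.
rewrite -/f -/(W _).
set P := \int[leb]_(t in `]0, 2 * M n]) _ => hP.
rewrite -/(Q n) -/kappa.
set E := \int[leb]_(t in `]M n, +oo[) `|G n t| in En *.
have E0 : 0 <= E by exact: Rintegral_ge0.
have Ireal0 : 0 <= \int[leb]_(t in Rpos) (f t ^+ 2).
  by apply: Rintegral_ge0 => t _; exact: sqr_ge0.
have LI : L * (\int[leb]_(t in Rpos) (f t ^+ 2)) <= eta.
  rewrite /L mulrAC ler_pdivrMr// -expr2 (le_trans _ I2n)//.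
  by apply: ler_wpM2r => //; apply: ler_powR; [exact: ltW|].
have LC : (2 * M n) `^ (2 * sigma - 1) / (2 * sigma - 1) / L = C * eta.
  rewrite powRM ?ltW// /L /C; field.
  by rewrite !gt_eqF.
have Pn : P <= (1 + C) / 2 * eta by rewrite LC in hP; exact: half_le LI hP.
have Em : E * M n `^ (sigma - 1) <= eta.
  rewrite (le_trans _ En)// mulrC; apply: ler_wpM2r => //.
  by apply: ler_powR; [exact: ltW|].
have kappa0 : 0 < kappa by apply: subr_powR2_gt0; exact: le_lt_trans sg0 sg1.
have k1 : 0 <= 1 + kappa^-1 by rewrite addr_ge0// invr_ge0 ltW.
have s3 : 0 <= 2 / (1 - sigma) by rewrite divr_ge0// ltW.
rewrite [K * eta](_ : _ = ((1 + C) / 2 * eta + eta) * (1 + kappa^-1) + eta * (2 / (1 - sigma))); last first.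
  by rewrite /K; ring.
by apply: lerD; apply: ler_wpM2r => //; apply: lerD.
Qed.

Lemma approx_orthogonal : \int[leb]_(t in Rpos) (phi t * T t) = 0.
Proof.
suff main eta : 0 < eta -> `|\int[leb]_(t in Rpos) (phi t * T t)| <= K * eta.
  apply/eqP; rewrite -normr_le0; apply/ler_addgt0Pr => e e0; rewrite add0r.
  have K1 : 0 < `|K| + 1 by rewrite ltr_wpDl.
  apply: le_trans (main _ (divr_gt0 e0 K1)) _.
  rewrite mulrA ler_pdivrMr// mulrC; apply: ler_wpM2l; first exact: ltW.
  by rewrite (le_trans (ler_norm _))// lerDl.
move=> eta0.
have [L2fin L2c] := (fine_cvgP _ _).1 L2_cvg.
have [_ tailc] := (fine_cvgP _ _).1 tail_cvg.
near \oo => n.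
have M1 : 1 < M n by near: n; move/cvgryPgt : Moo; exact.
have Qn : Q n <= eta.
  apply: (le_trans (ler_norm _)); apply: ltW.
  by near: n; move/cvgr0Pnorm_lt : Q_cvg; apply.
have fin : ((M n `^ (2 * sigma0 - 1))%:E *
    \int[leb]_(t in Rpos) ((phi t - gcross (G n) t) ^+ 2)%:E)%E \is a fin_num.
  by near: n; exact: L2fin.
have L2n : `|fine ((M n `^ (2 * sigma0 - 1))%:E *
    \int[leb]_(t in Rpos) ((phi t - gcross (G n) t) ^+ 2)%:E)%E| < eta ^+ 2.
  by near: n; move/cvgr0Pnorm_lt : L2c; apply; rewrite exprn_gt0.
have tailn : `|fine ((M n `^ (sigma0 - 1))%:E *
    \int[leb]_(t in `]M n, +oo[) `|G n t|%:E)%E| < eta.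
  by near: n; move/cvgr0Pnorm_lt : tailc; apply.
exact: (approx_bound_at eta0 M1 Qn fin L2n tailn).
Unshelve. all: by end_near. Qed.

End Sequence.
End Limit.

(** * Conclusion *)

Lemma Rintegral_combination d (T : measurableType d) (R : realType)
    (mu : {measure set T -> \bar R}) (D : set T) (I : eqType) (r : seq I)
    (f : I -> T -> R) (c : I -> R) : measurable D ->
  (forall k, k \in r -> mu.-integrable D (EFin \o f k)) ->
  mu.-integrable D (EFin \o (fun x => \sum_(k <- r) c k * f k x)) /\
  \int[mu]_(x in D) (\sum_(k <- r) c k * f k x) =
    \sum_(k <- r) c k * \int[mu]_(x in D) f k x.
Proof.
move=> mD; elim: r => [_|k r IH fi].
  rewrite (_ : (fun x => _) = cst 0); last by apply/funext => x; rewrite big_nil.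
  by split; [exact: integrable0|rewrite big_nil Rintegral_cst// mul0r].
have [i IHE] := IH (fun j jr => fi j (@mem_behead _ (k :: r) j jr)).
rewrite (_ : (fun x => _) = (fun x => c k * f k x + \sum_(j <- r) c j * f j x)); last first.
  by apply/funext => x; rewrite big_cons.
have ik := fi k (mem_head _ _).
have cik : mu.-integrable D (EFin \o (fun x => c k * f k x)) by exact: (integrableZl mD (c k) ik).
rewrite big_cons (RintegralD mD cik i) (RintegralZl _ mD ik) IHE.
by split=> //; exact: (integrableD mD cik i).
Qed.

Section Combination.
Variable R : realType.
Local Notation cara := (caratheodory_type (wlength (R := R) idfun)^*%mu).
Local Notation leb := (@completed_lebesgue_measure R).

Lemma gcross_combination (I : eqType) (r : seq I) (g : I -> R -> R)
    (c : I -> R) (t : R) :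
  (forall k, k \in r -> leb.-integrable Rpos (fun x => (g k x / x)%:E)) ->
  0 < t ->
  \sum_(k <- r) c k * gcross (g k) t =
  gcross (fun x => \sum_(k <- r) c k * g k x) t.
Proof.
move=> ig' t0.
have i1 k : k \in r ->
    leb.-integrable Rpos (EFin \o (fun x => fracpart (x / t) * g k x / x)).
  move=> kr; have := gcross_integrand_integrable (ig' k kr) t0.
  by apply: eq_integrable => [|x _]; [exact: itv_measurable|rewrite /= mulrA].
rewrite /gcross -(Rintegral_combination _ (itv_measurable _) i1).2.
apply: eq_Rintegral => x _; rewrite mulr_sumr mulr_suml.
by apply: eq_bigr => k _; ring.
Qed.

End Combination.

Section MellinVanishes.
Variable R : realType.
Local Open Scope complex_scope.
Local Notation normc := Normc.normc.
Local Notation cara := (caratheodory_type (wlength (R := R) idfun)^*%mu).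
Local Notation leb := (@completed_lebesgue_measure R).

Lemma cmeasurable_cpow (a : R[i]) : cmeasurable (Rpos : set cara) (fun t : R => cpow t a).
Proof.
have ml : measurable_fun (Rpos : set cara) (@ln R).
  by apply: cara_measurable_fun; [exact: measurable_itv|exact: measurable_funTS].
have [mRe mIm] := cmeasurable_cexp a ml.
by split; [move: mRe|move: mIm]; apply: eq_measurable_fun => t /in_Rpos t0;
  rewrite /comp (cpow_ln a t0).
Qed.

Lemma normc_cpow (t : R) (a : R[i]) : 0 < t -> normc (cpow t a) = t `^ complex.Re a.
Proof.
move=> t0; rewrite cpow_ln// normc_cexp cReM/= mulr0 subr0.
by rewrite /powR gt_eqF.
Qed.

Lemma Rintegral_fracpart_eq0 (sigma : R) (T : R -> R) (x : R) : 0 < sigma < 1 -> 0 < x ->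
  measurable_fun (Rpos : set cara) T ->
  (forall t, 0 < t -> `|T t| <= t `^ (sigma - 1)) ->
  \int[leb]_(t in Rpos) (fracpart (x / t) * T t) = 0 ->
  (\int[leb]_(t in Rpos) (fracpart (x / t) * T t)%:E = 0)%E.
Proof.
move=> s01 x0 mT T_le h.
have mK : measurable_fun (Rpos : set cara) (fun t : R => fracpart (x / t)).
  apply: cara_measurable_fun; first exact: measurable_itv.
  by apply: measurable_fracpart_div; exact: measurable_itv.
have iK : leb.-integrable Rpos (EFin \o (fun t => fracpart (x / t) * t `^ (sigma - 1))).
  apply/integrableP; split.
    apply/measurable_EFinP/measurable_funM; first exact: mK.
    by apply: cara_measurable_fun; [exact: measurable_itv|exact: measurable_powRe].
  rewrite (_ : integral _ _ _ =
      \int[leb]_(t in Rpos) (fracpart (x / t) * t `^ (sigma - 1))%:E)%E; last first.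
    by apply: eq_integral => t _; rewrite /= ger0_norm ?mulr_ge0 ?fracpart_ge0 ?powR_ge0.
  exact: le_lt_trans (integral_fracpart_le s01 x0) (ltry _).
have iT : leb.-integrable Rpos (EFin \o (fun t => fracpart (x / t) * T t)).
  apply: (le_integrable (itv_measurable _) _ _ iK).
    by apply/measurable_EFinP/measurable_funM; [exact: mK|exact: mT].
  move=> t /mem_set/in_Rpos t0; rewrite /= lee_fin !normrM.
  apply: ler_wpM2l; first exact: normr_ge0.
  by rewrite (ger0_norm (powR_ge0 _ _)); exact: T_le.
have fin := integrable_fin_num (itv_measurable _) iT.
by rewrite -(fineK fin); congr EFin.
Qed.

Variables (zeta : R[i] -> R[i]) (sigma0 : R) (g : nat -> R -> R) (phi : R -> R).
Variables (c : nat -> nat -> R) (M : nat -> R) (s : R[i]).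
Hypothesis hzeta : is_riemann_zeta zeta.
Hypothesis sigma01 : sigma0 < 1.
Hypothesis ig : forall k, (1 <= k)%N -> leb.-integrable Rpos (fun x => (g k x)%:E).
Hypothesis ig' : forall k, (1 <= k)%N -> leb.-integrable Rpos (fun x => (g k x / x)%:E).
Hypothesis mphi : lebesgue_measurable Rpos phi.
Hypothesis hphi : (\int[leb]_(t in Rpos) ((1 + t) * `|phi t| ^+ 2)%:E < +oo)%E.
Hypothesis Moo : M n @[n --> \oo] --> +oo.
Hypothesis L2_cvg : ((M n `^ (2 * sigma0 - 1))%:E *
  \int[leb]_(t in Rpos)
    ((phi t - \sum_(1 <= k < n.+1) c k n * gcross (g k) t) ^+ 2)%:E)%E
  @[n --> \oo] --> 0%E.
Hypothesis tail_cvg : ((M n `^ (sigma0 - 1))%:E *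
  \int[leb]_(t in `]M n, +oo[) `|\sum_(1 <= k < n.+1) c k n * g k t|%:E)%E
  @[n --> \oo] --> 0%E.

(** The orthogonality statements are real, and are applied to the real and to the
    imaginary part of [t^(s-1)], both of modulus at most [t^(sigma-1)]. *)
Lemma mellin_eq0 : 1 / 2 < complex.Re s -> complex.Re s <= sigma0 -> zeta s = 0 ->
  mellin phi s = 0.
Proof.
move=> s1 s2 zs0.
have s01 : 0 < complex.Re s < 1 by have h := sigma01; apply/andP; split; lra.
have Re1 : complex.Re (s - 1) = complex.Re s - 1 by exact: cReB.
have igr (h : nat -> R -> R) : (forall k, (1 <= k)%N -> leb.-integrable Rpos (EFin \o h k)) ->
    forall n k, k \in index_iota 1 n.+1 -> leb.-integrable Rpos (EFin \o h k).
  by move=> hi n k; rewrite mem_index_iota => /andP[k1 _]; exact: hi.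
have Re_realM (a : R) z : complex.Re (a%:C * z) = a * complex.Re z.
  by rewrite cReM/= mul0r subr0.
have Im_realM (a : R) z : complex.Im (a%:C * z) = a * complex.Im z.
  by rewrite cImM/= mul0r addr0.
pose G n x := \sum_(1 <= k < n.+1) c k n * g k x.
have iG n : leb.-integrable Rpos (fun x => (G n x)%:E).
  exact: (Rintegral_combination (fun k => c k n) (itv_measurable _) (igr _ ig n)).1.
have iG' n : leb.-integrable Rpos (fun x => (G n x / x)%:E).
  have := (Rintegral_combination (fun k => c k n) (itv_measurable _) (igr (fun k x => g k x / x) ig' n)).1.
  apply: eq_integrable => [|x _]; first exact: itv_measurable.
  by rewrite /= /G mulr_suml; congr EFin; apply: eq_bigr => k _; rewrite mulrA.
have L2c : ((M n `^ (2 * sigma0 - 1))%:E *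
  \int[leb]_(t in Rpos) ((phi t - gcross (G n) t) ^+ 2)%:E)%E @[n --> \oo] --> 0%E.
  apply: cvg_trans L2_cvg; apply: near_eq_cvg; apply: nearW => n; congr (_ * _)%E.
  apply: eq_integral => t /in_Rpos t0.
  by rewrite (gcross_combination (fun k => c k n) (igr (fun k x => g k x / x) ig' n) t0).
have kill (T : R -> R) : measurable_fun (Rpos : set cara) T ->
    (forall t, 0 < t -> `|T t| <= normc (cpow t (s - 1))) ->
    (forall x, 0 < x -> \int[leb]_(t in Rpos) (fracpart (x / t) * T t) = 0) ->
    \int[leb]_(t in Rpos) (phi t * T t) = 0.
  move=> mT T_le T0.
  have T_le' t : 0 < t -> `|T t| <= t `^ (complex.Re s - 1).
    by move=> t0; rewrite -Re1 -normc_cpow//; exact: T_le.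
  apply: (approx_orthogonal (conj s1 (conj s2 sigma01)) mphi hphi iG iG' mT T_le' _ Moo L2c tail_cvg).
  by move=> x x0; exact: (Rintegral_fracpart_eq0 s01 x0 mT T_le' (T0 x x0)).
have K x : 0 < x -> cint leb Rpos (fun t => (fracpart (x / t))%:C * cpow t (s - 1)) = 0.
  by move=> x0; exact: mellin_fracpart_eq0 zs0 s01 x0.
have hRe : \int[leb]_(t in Rpos) (phi t * complex.Re (cpow t (s - 1))) = 0.
  apply: kill; first exact: (cmeasurable_cpow _).1.
    by move=> t _; exact: ler_Re_normc.
  move=> x x0; transitivity (complex.Re (cint leb Rpos
    (fun t => (fracpart (x / t))%:C * cpow t (s - 1)))); last by rewrite K.
  by apply: eq_Rintegral => t _; apply/esym; exact: Re_realM.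
have hIm : \int[leb]_(t in Rpos) (phi t * complex.Im (cpow t (s - 1))) = 0.
  apply: kill; first exact: (cmeasurable_cpow _).2.
    by move=> t _; exact: ler_Im_normc.
  move=> x x0; transitivity (complex.Im (cint leb Rpos
    (fun t => (fracpart (x / t))%:C * cpow t (s - 1)))); last by rewrite K.
  by apply: eq_Rintegral => t _; apply/esym; exact: Im_realM.
rewrite /mellin /cintegral -[RHS]/(0 +i* 0); congr (_ +i* _).
  by rewrite -[RHS]hRe; apply: eq_Rintegral => t _; exact: Re_realM.
by rewrite -[RHS]hIm; apply: eq_Rintegral => t _; exact: Im_realM.
Qed.

End MellinVanishes.

Theorem theorem3 (R : realType) (zeta : R[i]%C -> R[i]%C)
    (hzeta : is_riemann_zeta zeta)
    (sigma0 : R) (hsigma0 : 1 / 2 < sigma0 < 1)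
    (g : nat -> R -> R)
    (hg : forall k : nat, (1 <= k)%N -> leb.-integrable Rpos (fun x => (g k x)%:E))
    (hg' : forall k : nat, (1 <= k)%N ->
       leb.-integrable Rpos (fun x => (g k x / x)%:E))
    (phi : R -> R)
    (mphi : lebesgue_measurable Rpos phi)
    (hphi : (\int[leb]_(t in Rpos) ((1 + t) * `|phi t| ^+ 2)%:E < +oo)%E)
    (hmellin : forall s : R[i]%C, 1 / 2 < complex.Re s -> complex.Re s <= sigma0 ->
       mellin phi s != 0)
    (happrox : exists (c : nat -> nat -> R) (M : nat -> R),
       [/\ M n @[n --> \oo] --> +oo,
           ((M n `^ (2 * sigma0 - 1))%:E *
              \int[leb]_(t in Rpos)
                 ((phi t - \sum_(1 <= k < n.+1) c k n * gcross (g k) t) ^+ 2)%:E)%E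
             @[n --> \oo] --> 0%E
         & ((M n `^ (sigma0 - 1))%:E *
              \int[leb]_(t in `]M n, +oo[)
                 `|\sum_(1 <= k < n.+1) c k n * g k t|%:E)%E
             @[n --> \oo] --> 0%E]) :
  forall s : R[i]%C, 1 / 2 < complex.Re s -> complex.Re s <= sigma0 -> zeta s != 0.
Proof.
move=> s s1 s2; apply/eqP => zs0.
have [_ sigma01] := andP hsigma0.
have [c [M [Moo L2_cvg tail_cvg]]] := happrox.
have /eqP := hmellin s s1 s2; apply.
exact: mellin_eq0 hzeta sigma01 hg hg' mphi hphi Moo L2_cvg tail_cvg s1 s2 zs0.
Qed.
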